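(* ($\mathbf{ZF}$) Let $\langle X,d\rangle$ be a compact Hausdorff quasi-metric space (that is, $d$ is a quasi-metric on $X$ and $\langle X,\tau(d)\rangle$ is compact and Hausdorff) such that $\langle X,\tau(d^{-1})\rangle$ is iso-dense. Then $\langle X,\tau(d)\rangle$ is metrizable.
   Context: The result is in $\mathbf{ZF}$ (no axiom of choice). A quasi-metric on $X$ is a function $d:X\times X\to[0,+\infty)$ such that, for all $x,y,z\in X$, $d(x,y)\le d(x,z)+d(z,y)$, and $d(x,y)=0$ iff $x=y$ (symmetry is not required). Its conjugate is $d^{-1}(x,y)=d(y,x)$. $B_d(x,r)=\{y\in X: d(x,y)<r\}$, and $\tau(d)=\{V\subseteq X:(\forall x\in V)(\exists n\in\omega)\ B_d(x,2^{-n})\subseteq V\}$. A topological space is iso-dense if its set of isolated points is dense. Compact means every open cover has a finite subcover. *)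

(* Defs.v *)
(* A theorem "of ZF" is read here as a statement about every model of first-order
   ZF: quantifiers over sets range over the elements of an arbitrary model [M].
   Choice may then fail in [M], whatever choice principles the ambient logic of
   Rocq is extended with. *)

Set Implicit Arguments.
Unset Strict Implicit.
Unset Printing Implicit Defensive.

Record set_structure := SetStructure {
  set_carrier :> Type;
  set_mem : set_carrier -> set_carrier -> Prop
}.

Declare Scope zf_scope.
Delimit Scope zf_scope with zf.
Notation "x ∈ a" := (set_mem x a) (at level 70, no associativity) : zf_scope.
Local Open Scope zf_scope.

(* First-order formulas of the language {∈}, variables being de Bruijn indices.
   The axiom schemes must range over formulas only: with arbitrary Rocq predicates
   a model would inherit the axiom of choice from the ambient logic. *)
Inductive formula : Type :=
| Fmem (i j : nat)
| Feq (i j : nat)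
| Ffalse
| Fimp (p q : formula)
| Fall (p : formula).

Definition env_cons (M : Type) (x : M) (e : nat -> M) : nat -> M :=
  fun i => match i with O => x | S j => e j end.

Fixpoint sat (M : set_structure) (e : nat -> M) (p : formula) : Prop :=
  match p with
  | Fmem i j => e i ∈ e j
  | Feq i j => e i = e j
  | Ffalse => False
  | Fimp p q => sat e p -> sat e q
  | Fall p => forall x : M, sat (env_cons x e) p
  end.

Section SetNotions.
Variable M : set_structure.
Implicit Types a b n m p w x y z A B F X : M.

Definition is_subset A B : Prop := forall x, x ∈ A -> x ∈ B.

Definition is_empty z : Prop := forall x, ~ x ∈ z.

Definition is_upair a b p : Prop := forall x, x ∈ p <-> x = a \/ x = b.

(* Kuratowski: p = {{a}, {a, b}}. *)
Definition is_opair a b p : Prop :=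
  exists s t, is_upair a a s /\ is_upair a b t /\ is_upair s t p.

(* m = n ∪ {n}. *)
Definition is_succ n m : Prop := forall x, x ∈ m <-> x ∈ n \/ x = n.

Definition is_inductive w : Prop :=
  (exists z, is_empty z /\ z ∈ w) /\
  (forall n, n ∈ w -> exists m, is_succ n m /\ m ∈ w).

Definition is_omega w : Prop :=
  is_inductive w /\ (forall v : M, is_inductive v -> is_subset w v).

Record is_model_of_ZF : Prop := {
  zf_extensionality : forall a b, (forall x, x ∈ a <-> x ∈ b) -> a = b;
  zf_foundation : forall a, (exists x, x ∈ a) ->
    exists x, x ∈ a /\ forall y, y ∈ x -> ~ y ∈ a;
  zf_pairing : forall a b, exists p, is_upair a b p;
  zf_union : forall a, exists b, forall x, x ∈ b <-> exists y, y ∈ a /\ x ∈ y;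
  zf_power : forall a, exists b, forall x, x ∈ b <-> is_subset x a;
  zf_infinity : exists w, is_inductive w;
  zf_separation : forall (phi : formula) (e : nat -> M) a,
    exists b, forall x, x ∈ b <-> x ∈ a /\ sat (env_cons x e) phi;
  zf_replacement : forall (phi : formula) (e : nat -> M) a,
    (forall x y z, x ∈ a ->
       sat (env_cons y (env_cons x e)) phi ->
       sat (env_cons z (env_cons x e)) phi -> y = z) ->
    exists b, forall y,
      y ∈ b <-> exists x, x ∈ a /\ sat (env_cons y (env_cons x e)) phi
}.

(* A function that is an element of [M] is represented by a Rocq function on [M]
   whose restriction to the domain has a graph belonging to [M]; its values
   outside the domain are irrelevant. *)
Definition set_function A B (f : M -> M) : Prop :=
  (forall x, x ∈ A -> f x ∈ B) /\
  (exists g : M, forall p,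
     p ∈ g <-> exists x, x ∈ A /\ is_opair x (f x) p).

(* The same for functions from A × A to B. *)
Definition set_function2 A B (f : M -> M -> M) : Prop :=
  (forall x y, x ∈ A -> y ∈ A -> f x y ∈ B) /\
  (exists g : M, forall p,
     p ∈ g <-> exists x y q,
       x ∈ A /\ y ∈ A /\ is_opair x y q /\ is_opair q (f x y) p).

(* Binary relations on A. *)
Definition set_relation A (r : M -> M -> Prop) : Prop :=
  exists g : M, forall p,
    p ∈ g <-> exists x y, x ∈ A /\ y ∈ A /\ r x y /\ is_opair x y p.

Definition is_finite F : Prop :=
  exists w n (f : M -> M),
    is_omega w /\ n ∈ w /\ set_function n F f /\
    (forall x y, x ∈ n -> y ∈ n -> f x = f y -> x = y) /\
    (forall y, y ∈ F -> exists x, x ∈ n /\ f x = y).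

End SetNotions.

(* The real numbers of [M], i.e. a Dedekind-complete ordered field that is a set of
   [M]. ZF proves that it exists and is unique up to unique isomorphism.
   Completeness only concerns the subsets that belong to [M]. *)
Record real_field (M : set_structure) := RealField {
  reals :> M;
  rzero : M;
  rone : M;
  radd : M -> M -> M;
  rmul : M -> M -> M;
  rle : M -> M -> Prop;
  rzero_in : rzero ∈ reals;
  rone_in : rone ∈ reals;
  radd_set : set_function2 reals reals radd;
  rmul_set : set_function2 reals reals rmul;
  rle_set : set_relation reals rle;
  raddA : forall x y z, x ∈ reals -> y ∈ reals -> z ∈ reals ->
    radd x (radd y z) = radd (radd x y) z;
  raddC : forall x y, x ∈ reals -> y ∈ reals -> radd x y = radd y x;
  radd0 : forall x, x ∈ reals -> radd x rzero = x;
  raddN : forall x, x ∈ reals -> exists y, y ∈ reals /\ radd x y = rzero;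
  rmulA : forall x y z, x ∈ reals -> y ∈ reals -> z ∈ reals ->
    rmul x (rmul y z) = rmul (rmul x y) z;
  rmulC : forall x y, x ∈ reals -> y ∈ reals -> rmul x y = rmul y x;
  rmul1 : forall x, x ∈ reals -> rmul x rone = x;
  rmulV : forall x, x ∈ reals -> x <> rzero ->
    exists y, y ∈ reals /\ rmul x y = rone;
  rmulD : forall x y z, x ∈ reals -> y ∈ reals -> z ∈ reals ->
    rmul x (radd y z) = radd (rmul x y) (rmul x z);
  rone_neq0 : rone <> rzero;
  rle_refl : forall x, x ∈ reals -> rle x x;
  rle_anti : forall x y, x ∈ reals -> y ∈ reals -> rle x y -> rle y x -> x = y;
  rle_trans : forall x y z, x ∈ reals -> y ∈ reals -> z ∈ reals ->
    rle x y -> rle y z -> rle x z;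
  rle_total : forall x y, x ∈ reals -> y ∈ reals -> rle x y \/ rle y x;
  rle_add : forall x y z, x ∈ reals -> y ∈ reals -> z ∈ reals ->
    rle x y -> rle (radd x z) (radd y z);
  rle_mul : forall x y, x ∈ reals -> y ∈ reals ->
    rle rzero x -> rle rzero y -> rle rzero (rmul x y);
  rle_complete : forall S : M, is_subset S reals -> (exists x, x ∈ S) ->
    (exists b, b ∈ reals /\ forall x, x ∈ S -> rle x b) ->
    exists s, s ∈ reals /\ (forall x, x ∈ S -> rle x s) /\
      (forall b, b ∈ reals -> (forall x, x ∈ S -> rle x b) -> rle s b)
}.

Section QuasiMetrics.
Variables (M : set_structure) (R : real_field M).
Implicit Types (n m r w x y z V X : M) (d : M -> M -> M).

Definition rlt x y : Prop := rle R x y /\ x <> y.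

(* r = 2^{-n}, where w is the set ω of natural numbers and n ∈ w: the map
   k ↦ 2^{-k} is the function p on ω with p(0) = 1 and 2 p(k + 1) = p(k). *)
Definition is_neg_pow2 w n r : Prop :=
  exists p : M -> M,
    set_function w R p /\
    (forall z, z ∈ w -> is_empty z -> p z = rone R) /\
    (forall k m, k ∈ w -> m ∈ w -> is_succ k m -> radd R (p m) (p m) = p k) /\
    p n = r.

Definition is_quasi_metric X d : Prop :=
  set_function2 X R d /\
  (forall x y, x ∈ X -> y ∈ X -> rle R (rzero R) (d x y)) /\
  (forall x y z, x ∈ X -> y ∈ X -> z ∈ X ->
     rle R (d x y) (radd R (d x z) (d z y))) /\
  (forall x y, x ∈ X -> y ∈ X -> (d x y = rzero R <-> x = y)).

Definition is_metric X d : Prop :=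
  is_quasi_metric X d /\ (forall x y, x ∈ X -> y ∈ X -> d x y = d y x).

Definition conjugate d : M -> M -> M := fun x y => d y x.

(* The elements of B_d(x, r). *)
Definition in_ball X d x r y : Prop := y ∈ X /\ rlt (d x y) r.

(* V ∈ τ(d). *)
Definition tau X d V : Prop :=
  is_subset V X /\
  forall x, x ∈ V ->
    exists w n r, is_omega w /\ n ∈ w /\ is_neg_pow2 w n r /\
      forall y, in_ball X d x r y -> y ∈ V.

End QuasiMetrics.

(* A topology on X is given by the predicate "V is an open set", V ranging over
   the elements of [M]. *)
Section Topology.
Variable M : set_structure.
Implicit Types (x y F U V X : M) (T : M -> Prop).

Definition covers U X : Prop := forall x, x ∈ X -> exists V, V ∈ U /\ x ∈ V.

Definition is_compact X T : Prop :=
  forall U, (forall V, V ∈ U -> T V) -> covers U X ->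
    exists F, is_subset F U /\ is_finite F /\ covers F X.

Definition is_hausdorff X T : Prop :=
  forall x y, x ∈ X -> y ∈ X -> x <> y ->
    exists U V, T U /\ T V /\ x ∈ U /\ y ∈ V /\ forall z, ~ (z ∈ U /\ z ∈ V).

(* {x} is open. *)
Definition is_isolated X T x : Prop :=
  x ∈ X /\ exists s, is_upair x x s /\ T s.

Definition is_dense T (A : M -> Prop) : Prop :=
  forall V, T V -> (exists x, x ∈ V) -> exists x, x ∈ V /\ A x.

Definition is_iso_dense X T : Prop := is_dense T (is_isolated X T).

Definition is_metrizable (R : real_field M) X T : Prop :=
  exists rho : M -> M -> M, is_metric R X rho /\ forall V, T V <-> tau R X rho V.

End Topology.

(* Main.v *)
(* A compact Hausdorff quasi-metric space is metrizable without any choice. Call x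
   and y r-near when some ball B_d(u, r) contains both. Compactness is used through one
   principle: a definable property of pairs (r, x) that is inherited by smaller r and
   holds locally holds for one r at all x. With the Hausdorff axiom it shows that these
   relations form a base of a uniformity inducing τ(d): the stars of x are contained in
   its d-balls, and r-nearness composed with itself lies in e-nearness for small r. A
   countable base with e_(n+1) composed three times inside e_n gives a metric as the
   infimum of the weights of chains, by Frink's lemma.

   All of this takes place in a model of ZF, whose natural numbers need not be standard:
   recursive definitions are intersections of closed sets of the model, inductions are
   applied to definable predicates only, and inductions on lengths of chains are replaced
   by inductions along the reals of the model. *)
From Stdlib Require Import Arith Lia ClassicalEpsilon.
Require Import Defs.

Local Open Scope zf_scope.

(** * First-order definability *)

Section Definability.
Context {M : set_structure}.
Implicit Types (e c : nat -> M) (P Q : (nat -> M) -> Prop) (t u : (nat -> M) -> M).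

Lemma sat_ext (p : formula) : forall e e',
  (forall i, e i = e' i) -> sat e p <-> sat e' p.
Proof.
induction p as [i j|i j| |p IHp q IHq|p IHp]; intros e e' E; simpl.
- now rewrite !E.
- now rewrite !E.
- tauto.
- rewrite (IHp e e' E), (IHq e e' E). tauto.
- split; intros H x; specialize (H x); revert H; apply IHp; intros [|i]; simpl; auto.
Qed.

Fixpoint rename (f : nat -> nat) (p : formula) : formula :=
  match p with
  | Fmem i j => Fmem (f i) (f j)
  | Feq i j => Feq (f i) (f j)
  | Ffalse => Ffalse
  | Fimp p q => Fimp (rename f p) (rename f q)
  | Fall p => Fall (rename (fun i => match i with O => O | S j => S (f j) end) p)
  end.

Lemma sat_rename (p : formula) : forall f e,
  sat e (rename f p) <-> sat (fun i => e (f i)) p.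
Proof.
induction p as [i j|i j| |p IHp q IHq|p IHp]; intros f e; simpl; try tauto.
- rewrite IHp, IHq. tauto.
- split; intros H x; specialize (H x).
  + apply IHp in H. revert H. apply sat_ext. intros [|i]; reflexivity.
  + apply IHp. revert H. apply sat_ext. intros [|i]; reflexivity.
Qed.

(* Even positions hold the variables, odd positions the parameters. *)
Definition mix e c : nat -> M :=
  fun i => if Nat.even i then e (Nat.div2 i) else c (Nat.div2 i).

Lemma mix_even e c i : mix e c (2 * i) = e i.
Proof.
unfold mix. rewrite Nat.even_mul. cbn [Nat.even orb]. now rewrite Nat.div2_double.
Qed.

Lemma mix_odd e c i : mix e c (S (2 * i)) = c i.
Proof.
unfold mix. rewrite Nat.even_succ, Nat.odd_mul. cbn [Nat.odd Nat.even negb andb].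
now rewrite Nat.div2_succ_double.
Qed.

Lemma nat_parity i : exists j, i = 2 * j \/ i = S (2 * j).
Proof. exists (Nat.div2 i). pose proof (Nat.div2_odd i). destruct (Nat.odd i); simpl in *; lia. Qed.

(* Definability with parameters; a predicate on environments stands for a formula
   whose free variables are the [e i], so that a bound variable [x] may be written
   as a Rocq variable. *)
Definition definable P : Prop :=
  inhabited M -> exists phi c, forall e, P e <-> sat (mix e c) phi.

(** Definability of the graph: variable 0 is the value of the term, and the variables of [t] are
    shifted up by one. *)
Definition definable_term t : Prop :=
  definable (fun e => e 0 = t (fun i => e (S i))).

Definition definable1 (P : M -> Prop) : Prop := definable (fun e => P (e 0)).

Definition definable2 (P : M -> M -> Prop) : Prop :=
  definable (fun e => P (e 0) (e 1)).

Definition definable_op (f : M -> M -> M) : Prop :=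
  definable_term (fun e => f (e 0) (e 1)).

Definition definable_fun (f : M -> M) : Prop :=
  definable_term (fun e => f (e 0)).

Lemma definable_ext P Q : (forall e, P e <-> Q e) -> definable Q -> definable P.
Proof. intros H HQ inhM. destruct (HQ inhM) as (phi & c & E).
exists phi, c. intro e. rewrite H. apply E. Qed.

Lemma definable_rename P (f : nat -> nat) :
  definable P -> definable (fun e => P (fun i => e (f i))).
Proof.
intros HP inhM. destruct (HP inhM) as (phi & c & E).
exists (rename (fun i => if Nat.even i then 2 * f (Nat.div2 i) else i) phi), c.
intro e. rewrite sat_rename, E. apply sat_ext. intro k.
destruct (nat_parity k) as (i & [-> | ->]).
- rewrite mix_even, Nat.even_mul. cbn [Nat.even orb].
  now rewrite Nat.div2_double, mix_even.
- rewrite mix_odd, Nat.even_succ, Nat.odd_mul. cbn [Nat.odd Nat.even negb andb].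
  now rewrite mix_odd.
Qed.

(** The two parameter lists are interleaved once more: parameter i of [P] becomes parameter 2i of
    [mix c c'], and parameter i of [Q] becomes parameter 2i + 1. *)
Lemma definable_imp P Q :
  definable P -> definable Q -> definable (fun e => P e -> Q e).
Proof.
intros HP HQ inhM.
destruct (HP inhM) as (p & c & Ep), (HQ inhM) as (q & c' & Eq).
exists (Fimp (rename (fun i => if Nat.even i then i else S (2 * (2 * Nat.div2 i))) p)
             (rename (fun i => if Nat.even i then i else S (2 * S (2 * Nat.div2 i))) q)),
  (mix c c').
intro e. cbn [sat]. rewrite !sat_rename, Ep, Eq.
assert (H1 : forall k, mix e c k =
  mix e (mix c c') (if Nat.even k then k else S (2 * (2 * Nat.div2 k)))).
{ intro k. destruct (nat_parity k) as (i & [-> | ->]).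
  - rewrite Nat.even_mul. cbn [Nat.even orb]. now rewrite !mix_even.
  - rewrite Nat.even_succ, Nat.odd_mul. cbn [Nat.odd Nat.even negb andb].
    now rewrite Nat.div2_succ_double, !mix_odd, mix_even. }
assert (H2 : forall k, mix e c' k =
  mix e (mix c c') (if Nat.even k then k else S (2 * S (2 * Nat.div2 k)))).
{ intro k. destruct (nat_parity k) as (i & [-> | ->]).
  - rewrite Nat.even_mul. cbn [Nat.even orb]. now rewrite !mix_even.
  - rewrite Nat.even_succ, Nat.odd_mul. cbn [Nat.odd Nat.even negb andb].
    now rewrite Nat.div2_succ_double, !mix_odd. }
rewrite (sat_ext p _ _ H1), (sat_ext q _ _ H2). tauto.
Qed.

(** The quantifier puts [x] in front of the whole mixed environment, so variable 0 keeps index 0,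
    variable i + 1 moves to the shifted place of variable i, and parameters move up by one. *)
Lemma definable_all (Q : (nat -> M) -> M -> Prop) :
  definable (fun e => Q (fun i => e (S i)) (e 0)) ->
  definable (fun e => forall x, Q e x).
Proof.
intros HQ inhM. destruct (HQ inhM) as (p & c & E).
exists (Fall (rename (fun k => if Nat.even k then
    match Nat.div2 k with O => O | S i => S (2 * i) end else S k) p)), c.
intro e. cbn [sat].
assert (H : forall x, Q e x <-> sat (env_cons x (mix e c)) (rename (fun k => if Nat.even k then
    match Nat.div2 k with O => O | S i => S (2 * i) end else S k) p)).
{ intro x. rewrite sat_rename. rewrite (E (env_cons x e)). apply sat_ext. intro k.
  destruct (nat_parity k) as (i & [-> | ->]).
  - rewrite mix_even, Nat.even_mul. cbn [Nat.even orb]. rewrite Nat.div2_double.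
    destruct i as [|i]; [reflexivity|]. cbn [env_cons]. now rewrite mix_even.
  - rewrite mix_odd, Nat.even_succ, Nat.odd_mul. cbn [Nat.odd Nat.even negb andb env_cons].
    now rewrite mix_odd. }
split; intros G x; apply H; apply G.
Qed.

Lemma definable_False : definable (fun _ => False).
Proof. intros [a]. exists Ffalse, (fun _ => a). intro e. reflexivity. Qed.

Lemma definable_not P : definable P -> definable (fun e => ~ P e).
Proof. intro H. exact (definable_imp P _ H definable_False). Qed.

Lemma definable_and P Q : definable P -> definable Q -> definable (fun e => P e /\ Q e).
Proof.
intros HP HQ. apply definable_ext with (fun e => ~ (P e -> ~ Q e)).
- intro e. tauto.
- now apply definable_not, definable_imp, definable_not.
Qed.

Lemma definable_or P Q : definable P -> definable Q -> definable (fun e => P e \/ Q e).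
Proof.
intros HP HQ. apply definable_ext with (fun e => ~ P e -> Q e).
- intro e. tauto.
- now apply definable_imp; [apply definable_not|].
Qed.

Lemma definable_iff P Q : definable P -> definable Q -> definable (fun e => P e <-> Q e).
Proof.
intros HP HQ. apply (definable_and (fun e => P e -> Q e) (fun e => Q e -> P e));
  now apply definable_imp.
Qed.

Lemma definable_ex (Q : (nat -> M) -> M -> Prop) :
  definable (fun e => Q (fun i => e (S i)) (e 0)) ->
  definable (fun e => exists x, Q e x).
Proof.
intro H. apply definable_ext with (fun e => ~ forall x, ~ Q e x).
- intro e. split.
  + intros [x Hx] G. exact (G x Hx).
  + intro G. apply NNPP. intro N. apply G. intros x Hx. apply N. now exists x.
- apply definable_not, (definable_all (fun e x => ~ Q e x)), definable_not, H.
Qed.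

Lemma definable_eq_vars i j : definable (fun e => e i = e j).
Proof.
intros [a]. exists (Feq (2 * i) (2 * j)), (fun _ => a). intro e.
cbn [sat]. now rewrite !mix_even.
Qed.

Lemma definable_mem_vars i j : definable (fun e => e i ∈ e j).
Proof.
intros [a]. exists (Fmem (2 * i) (2 * j)), (fun _ => a). intro e.
cbn [sat]. now rewrite !mix_even.
Qed.

Lemma definable_var i : definable_term (fun e => e i).
Proof. exact (definable_eq_vars 0 (S i)). Qed.

Lemma definable_const a : definable_term (fun _ => a).
Proof. intros _. exists (Feq 0 1), (fun _ => a). intro e. reflexivity. Qed.

(** The value of the term is named by an existential quantifier, so that the graph of [t] is all
    that enters the formula. *)
Lemma definable_let (Q : (nat -> M) -> M -> Prop) t :
  definable_term t -> definable (fun e => Q (fun i => e (S i)) (e 0)) ->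
  definable (fun e => Q e (t e)).
Proof.
intros Ht HQ. apply definable_ext with (fun e => exists x, x = t e /\ Q e x).
- intro e. split; [intro; now exists (t e)|]. now intros (x & -> & H).
- now apply (definable_ex (fun e x => x = t e /\ Q e x)), definable_and.
Qed.

Lemma definable_term_shift t :
  definable_term t -> definable_term (fun e => t (fun i => e (S i))).
Proof.
exact (definable_rename (fun e => e 0 = t (fun i => e (S i)))
  (fun i => match i with O => O | S j => S (S j) end)).
Qed.

Lemma definable_subst1 (P : M -> Prop) t :
  definable1 P -> definable_term t -> definable (fun e => P (t e)).
Proof. intros HP Ht. exact (definable_let (fun e x => P x) t Ht HP). Qed.

Lemma definable_subst2 (P : M -> M -> Prop) t u :
  definable2 P -> definable_term t -> definable_term u ->
  definable (fun e => P (t e) (u e)).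
Proof.
intros HP Ht Hu. apply (definable_let (fun e x => P x (u e)) t Ht).
apply (definable_let (fun e y => P (e 0) y) _ (definable_term_shift u Hu)).
exact (definable_rename (fun e => P (e 0) (e 1))
  (fun i => match i with O => 1 | S O => O | S (S j) => S (S j) end) HP).
Qed.

Lemma definable_eq t u :
  definable_term t -> definable_term u -> definable (fun e => t e = u e).
Proof. exact (definable_subst2 eq t u (definable_eq_vars 0 1)). Qed.

Lemma definable_mem t u :
  definable_term t -> definable_term u -> definable (fun e => t e ∈ u e).
Proof. exact (definable_subst2 (@set_mem M) t u (definable_mem_vars 0 1)). Qed.

Lemma definable_app f t :
  definable_fun f -> definable_term t -> definable_term (fun e => f (t e)).
Proof.
intros Hf Ht.
apply (definable_let (fun e x => e 0 = f x) _ (definable_term_shift t Ht)).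
exact (definable_rename (fun e => e 0 = f (e 1))
  (fun i => match i with O => 1 | S O => O | S (S j) => S (S j) end) Hf).
Qed.

Lemma definable_app2 f t u :
  definable_op f -> definable_term t -> definable_term u ->
  definable_term (fun e => f (t e) (u e)).
Proof.
intros Hf Ht Hu.
apply (definable_let (fun e x => e 0 = f x (u (fun i => e (S i)))) _
  (definable_term_shift t Ht)).
apply (definable_let (fun e y => e 1 = f (e 0) y) _
  (definable_term_shift _ (definable_term_shift u Hu))).
exact (definable_rename (fun e => e 0 = f (e 1) (e 2))
  (fun i => match i with O => 2 | S O => 1 | S (S O) => O | S j => S j end) Hf).
Qed.

End Definability.

(* Syntax-directed proofs of definability *)
Create HintDb definability discriminated.

(** Atoms and connectives are tried before the application of a predicate or an operation, whose own
    definability is sought in the hint base. *)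
Ltac definability_step :=
  cbv beta;
  match goal with
  | |- definable1 _ => unfold definable1
  | |- definable2 _ => unfold definable2
  | |- definable_fun _ => unfold definable_fun, definable_term
  | |- definable_op _ => unfold definable_op, definable_term
  | |- definable (fun e => _ ∈ _) => apply definable_mem
  | |- definable (fun e => _ = _) => apply definable_eq
  | |- definable (fun e => ~ _) => apply definable_not
  | |- definable (fun e => False) => apply definable_False
  | |- definable (fun e => _ /\ _) => apply definable_and
  | |- definable (fun e => _ \/ _) => apply definable_or
  | |- definable (fun e => _ <-> _) => apply definable_iff
  | |- definable (fun e => _ -> _) => apply definable_imp
  | |- definable (fun e => exists x, _) => apply definable_ex
  | |- definable (fun e => forall x, _) => apply definable_all
  | |- definable (fun e => ?P _) =>
      apply (definable_subst1 P); [solve [auto with definability] |]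
  | |- definable (fun e => ?P _ _) =>
      apply (definable_subst2 P); [solve [auto with definability] | |]
  | |- definable_term (fun e => ?c) => apply definable_const
  | |- definable_term (fun e => e _) => apply definable_var
  | |- definable_term (fun e => ?f _) =>
      apply (definable_app f); [solve [auto with definability] |]
  | |- definable_term (fun e => ?f _ _) =>
      apply (definable_app2 f); [solve [auto with definability] | |]
  end.

Ltac definability := repeat definability_step.

(** * Sets of a model of ZF *)

Section ZF.
Context {M : set_structure} (zfM : is_model_of_ZF M).
Implicit Types a b p x y z A B S w : M.

Lemma inhabited_model : inhabited M.
Proof. destruct (zf_infinity zfM) as [w _]. now constructor. Qed.

Lemma separation (P : M -> Prop) A :
  definable1 P -> exists b, forall x, x ∈ b <-> x ∈ A /\ P x.
Proof.
intro HP. destruct (HP inhabited_model) as (phi & c & E).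
(* The defining formula is evaluated in the environment that is constantly [x], so all its variables
   are merged into index 0 and only the parameters stay apart. *)
destruct (zf_separation zfM
  (rename (fun k => if Nat.even k then O else S (Nat.div2 k)) phi) c A) as [b Hb].
exists b. intro x. rewrite Hb, sat_rename, (E (fun _ => x)).
apply and_iff_compat_l, sat_ext. intro k.
destruct (nat_parity k) as (i & [-> | ->]).
- now rewrite mix_even, Nat.even_mul.
- rewrite mix_odd, Nat.even_succ, Nat.odd_mul. cbn [Nat.odd Nat.even negb andb env_cons].
  now rewrite Nat.div2_succ_double.
Qed.

Lemma is_opair_ex a b : exists p, is_opair a b p.
Proof.
destruct (zf_pairing zfM a a) as [s Hs], (zf_pairing zfM a b) as [t Ht].
destruct (zf_pairing zfM s t) as [p Hp]. now exists p, s, t.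
Qed.

Lemma is_opair_fun a b p p' : is_opair a b p -> is_opair a b p' -> p = p'.
Proof.
intros (s & t & Hs & Ht & Hp) (s' & t' & Hs' & Ht' & Hp').
assert (s = s') as <-.
{ apply (zf_extensionality zfM). intro x. rewrite (Hs x), (Hs' x). tauto. }
assert (t = t') as <-.
{ apply (zf_extensionality zfM). intro x. rewrite (Ht x), (Ht' x). tauto. }
apply (zf_extensionality zfM). intro x. rewrite (Hp x), (Hp' x). tauto.
Qed.

Lemma is_opair_inj a b a' b' p :
  is_opair a b p -> is_opair a' b' p -> a = a' /\ b = b'.
Proof.
intros (s & t & Hs & Ht & Hp) (s' & t' & Hs' & Ht' & Hp').
assert (Ha : a = a').
{ assert (G : s = s' \/ s = t') by (apply Hp', Hp; auto). destruct G as [<- | <-].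
  - destruct (proj1 (Hs' a)); auto. apply Hs. auto.
  - symmetry. destruct (proj1 (Hs a')); auto. apply Ht'. auto. }
subst a'. split; [reflexivity|].
assert (G : b = a \/ b = b').
{ assert (G : t = s' \/ t = t') by (apply Hp', Hp; auto). destruct G as [<- | <-].
  - left. destruct (proj1 (Hs' b)); auto. apply Ht. auto.
  - apply Ht', Ht. auto. }
assert (G' : b' = a \/ b' = b).
{ assert (G' : t' = s \/ t' = t) by (apply Hp, Hp'; auto). destruct G' as [<- | <-].
  - left. destruct (proj1 (Hs b')); auto. apply Ht'. auto.
  - apply Ht, Ht'. auto. }
destruct G as [-> | ->]; [|reflexivity]. destruct G' as [-> | ->]; reflexivity.
Qed.

(** The ambient [epsilon] merely names a set that is unique; definability is obtained from the
    formula [is_opair]. *)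
Definition opair a b : M := epsilon inhabited_model (is_opair a b).

Lemma opair_spec a b p : p = opair a b <-> is_opair a b p.
Proof.
assert (G : is_opair a b (opair a b)) by (unfold opair; apply epsilon_spec, is_opair_ex).
split; [now intros ->|]. intro H. exact (is_opair_fun a b p _ H G).
Qed.

Lemma opair_inj a b a' b' : opair a b = opair a' b' -> a = a' /\ b = b'.
Proof.
intro H. apply (is_opair_inj a b a' b' (opair a b)); now apply opair_spec.
Qed.

Lemma definable_opair : definable_op opair.
Proof.
apply definable_ext with (fun e => is_opair (e 1) (e 2) (e 0)).
- intro e. apply opair_spec.
- unfold is_opair, is_upair. definability.
Qed.
Hint Resolve definable_opair : definability.

(** Kuratowski pairs of elements of [A] and [B] belong to the double power set of A ∪ B, from which
    separation cuts out the product. *)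
Lemma product A B :
  exists C, forall p, p ∈ C <-> exists a b, a ∈ A /\ b ∈ B /\ p = opair a b.
Proof.
destruct (zf_pairing zfM A B) as [AB HAB], (zf_union zfM AB) as [U HU].
destruct (zf_power zfM U) as [PU HPU], (zf_power zfM PU) as [PPU HPPU].
destruct (separation (fun p => exists a b, a ∈ A /\ b ∈ B /\ p = opair a b) PPU)
  as [C HC]; [definability|].
exists C. intro p. rewrite HC. split; [tauto|]. intro H. split; [|exact H].
destruct H as (a & b & Ha & Hb & ->).
assert (Ua : a ∈ U) by (apply HU; exists A; rewrite (HAB A); auto).
assert (Ub : b ∈ U) by (apply HU; exists B; rewrite (HAB B); auto).
destruct (proj1 (opair_spec a b _) eq_refl) as (s & t & Hs & Ht & Hp).
apply HPPU. intros x Hx. apply HPU. intros y Hy.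
apply Hp in Hx. destruct Hx as [-> | ->].
- apply Hs in Hy. destruct Hy; now subst.
- apply Ht in Hy. destruct Hy; now subst.
Qed.

Lemma separation2 (P : M -> M -> Prop) A B : definable2 P ->
  exists S, forall a b, opair a b ∈ S <-> a ∈ A /\ b ∈ B /\ P a b.
Proof.
intro HP. destruct (product A B) as [C HC].
destruct (separation (fun p => exists a b, p = opair a b /\ P a b) C) as [S HS];
  [definability|].
exists S. intros a b. rewrite HS, HC. split.
- intros ((a1 & b1 & Ha & Hb & E1) & a2 & b2 & E2 & H).
  apply opair_inj in E1, E2. destruct E1, E2. now subst.
- intros (Ha & Hb & H). split; exists a, b; auto.
Qed.

(* The least subset of A × B that contains [I] and is closed under the
   transitions [T], obtained as an intersection rather than by recursion on ω. *)
Definition reach A B (I : M -> M -> Prop) (T : M -> M -> M -> M -> Prop) a b : Prop :=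
  a ∈ A /\ b ∈ B /\
  forall S,
    (forall x y, x ∈ A -> y ∈ B -> I x y -> opair x y ∈ S) ->
    (forall x y x' y', x ∈ A -> y ∈ B -> x' ∈ A -> y' ∈ B ->
       opair x y ∈ S -> T x y x' y' -> opair x' y' ∈ S) ->
    opair a b ∈ S.

Section Reach.
Variables (A B : M) (I : M -> M -> Prop) (T : M -> M -> M -> M -> Prop).

Lemma reach_init a b : a ∈ A -> b ∈ B -> I a b -> reach A B I T a b.
Proof. intros Ha Hb H. split; [|split]; auto. Qed.

Lemma reach_step a b a' b' : a' ∈ A -> b' ∈ B ->
  reach A B I T a b -> T a b a' b' -> reach A B I T a' b'.
Proof.
intros Ha' Hb' (Ha & Hb & H) HT. split; [|split]; auto.
intros S HI HS. apply (HS a b); auto.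
Qed.

(** The pairs satisfying both [reach] and [P] form a set of the model that is closed under the
    rules, hence one of the sets intersected in [reach]. Including [reach] in it makes reachability
    available in the step. *)
Lemma reach_ind (P : M -> M -> Prop) : definable2 (reach A B I T) -> definable2 P ->
  (forall x y, x ∈ A -> y ∈ B -> I x y -> P x y) ->
  (forall x y x' y', x ∈ A -> y ∈ B -> x' ∈ A -> y' ∈ B ->
     reach A B I T x y -> P x y -> T x y x' y' -> P x' y') ->
  forall a b, reach A B I T a b -> P a b.
Proof.
intros HR HP HI HT a b (Ha & Hb & H).
destruct (separation2 (fun x y => reach A B I T x y /\ P x y) A B) as [S HS];
  [apply definable_and; [exact HR|exact HP]|].
apply (HS a b), H.
- intros x y Hx Hy Hxy. apply HS. auto using reach_init.
- intros x y x' y' Hx Hy Hx' Hy' Hxy H'. apply HS. apply HS in Hxy.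
  destruct Hxy as (_ & _ & Hxy & HPxy). split; [|split; [|split]]; auto.
  + now apply (reach_step x y).
  + now apply (HT x y x' y').
Qed.

End Reach.

(** Outside its domain a Rocq function representing a function of the model is arbitrary and so
    possibly undefinable; the constant value [c] there makes it definable everywhere. *)
Definition total_op A c (f : M -> M -> M) x y : M :=
  if excluded_middle_informative (x ∈ A /\ y ∈ A) then f x y else c.

Lemma total_op_eq A c f x y : x ∈ A -> y ∈ A -> total_op A c f x y = f x y.
Proof. intros Hx Hy. unfold total_op. destruct excluded_middle_informative; tauto. Qed.

Lemma total_op_in A B c f x y :
  set_function2 A B f -> c ∈ B -> total_op A c f x y ∈ B.
Proof.
intros [Hf _] Hc. unfold total_op. destruct excluded_middle_informative; [apply Hf; tauto|auto].
Qed.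

Lemma definable_total_op A B c f : set_function2 A B f -> definable_op (total_op A c f).
Proof.
intros [_ [g Hg]].
apply definable_ext with (fun e =>
  (e 1 ∈ A /\ e 2 ∈ A /\ opair (opair (e 1) (e 2)) (e 0) ∈ g) \/
  (~ (e 1 ∈ A /\ e 2 ∈ A) /\ e 0 = c)); [|definability].
intro e. unfold total_op. destruct excluded_middle_informative as [[H1 H2]|N]; [|tauto].
split.
- intros ->. left. split; [|split]; auto. apply Hg.
  exists (e 1), (e 2), (opair (e 1) (e 2)). repeat split; auto; now apply opair_spec.
- intros [(_ & _ & H) | H]; [|tauto]. apply Hg in H.
  destruct H as (x & y & q & _ & _ & Hq & Hp). apply opair_spec in Hq, Hp. subst q.
  apply opair_inj in Hp. destruct Hp as [Hq ->]. apply opair_inj in Hq.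
  now destruct Hq as [-> ->].
Qed.

Definition total_fun A c (f : M -> M) x : M :=
  if excluded_middle_informative (x ∈ A) then f x else c.

Lemma total_fun_eq A c f x : x ∈ A -> total_fun A c f x = f x.
Proof. intros Hx. unfold total_fun. destruct excluded_middle_informative; tauto. Qed.

Lemma definable_total_fun A B c f : set_function A B f -> definable_fun (total_fun A c f).
Proof.
intros [_ [g Hg]].
apply definable_ext with (fun e =>
  (e 1 ∈ A /\ opair (e 1) (e 0) ∈ g) \/ (~ e 1 ∈ A /\ e 0 = c)); [|definability].
intro e. unfold total_fun. destruct excluded_middle_informative as [H1|N]; [|tauto].
split.
- intros ->. left. split; auto. apply Hg.
  exists (e 1). split; auto; now apply opair_spec.
- intros [(_ & H) | H]; [|tauto]. apply Hg in H.
  destruct H as (x & _ & Hp). apply opair_spec, opair_inj in Hp. now destruct Hp as [-> ->].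
Qed.

Lemma definable_set_relation A r : set_relation A r ->
  definable2 (fun x y => x ∈ A /\ y ∈ A /\ r x y).
Proof.
intros [g Hg]. apply definable_ext with (fun e => opair (e 0) (e 1) ∈ g); [|definability].
intro e. rewrite Hg. split.
- intros (H1 & H2 & H). exists (e 0), (e 1). repeat split; auto; now apply opair_spec.
- intros (x & y & Hx & Hy & H & Hp). apply opair_spec, opair_inj in Hp.
  now destruct Hp as [-> ->].
Qed.

Lemma set_function2_of_definable A B f : definable_op f ->
  (forall x y, x ∈ A -> y ∈ A -> f x y ∈ B) -> set_function2 A B f.
Proof.
intros Hf HB. split; [exact HB|].
destruct (product A A) as [AA HAA], (product AA B) as [C HC].
destruct (separation (fun p => exists x y, x ∈ A /\ y ∈ A /\ p = opair (opair x y) (f x y)) C)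
  as [g Hg]; [definability|].
exists g. intro p. rewrite Hg. split.
- intros (_ & x & y & Hx & Hy & ->). exists x, y, (opair x y).
  repeat split; auto; now apply opair_spec.
- intros (x & y & q & Hx & Hy & Hq & Hp). apply opair_spec in Hq, Hp. subst q p. split.
  + apply HC. exists (opair x y), (f x y). repeat split; auto. apply HAA. exists x, y. auto.
  + exists x, y. auto.
Qed.

(** Separation cuts an inductive set out of [w], and [w] is contained in every inductive set. *)
Lemma omega_ind w (P : M -> Prop) : is_omega w -> definable1 P ->
  (forall z, is_empty z -> P z) ->
  (forall k m, k ∈ w -> m ∈ w -> is_succ k m -> P k -> P m) ->
  forall n, n ∈ w -> P n.
Proof.
intros [Hw Hmin] HP H0 HS n Hn. destruct (separation P w HP) as [S HSep].
apply HSep, Hmin; [|exact Hn]. split.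
- destruct Hw as [(z & Hz & Hzw) _]. exists z. split; [exact Hz|]. apply HSep. auto.
- intros k Hk. apply HSep in Hk. destruct Hk as [Hk HPk].
  destruct Hw as [_ Hw]. destruct (Hw k Hk) as (m & Hm & Hmw). exists m.
  split; [exact Hm|]. apply HSep. split; [exact Hmw|]. now apply (HS k m).
Qed.

(** * Reals of the model *)

Section Reals.
Context (R : real_field M).
Implicit Types (q r s t : M).

Notation "0" := (rzero R).
Notation "1" := (rone R).

(** With the default value 0, sums lie in [R] unconditionally; likewise [le] carries the membership
    of both sides in [R]. *)
Definition add : M -> M -> M := total_op R 0 (@radd M R).
Definition le x y : Prop := x ∈ R /\ y ∈ R /\ rle R x y.
Definition lt x y : Prop := le x y /\ x <> y.

Notation "x + y" := (add x y).
Notation "x <= y" := (le x y).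
Notation "x < y" := (lt x y).

Lemma definable_add : definable_op add.
Proof. apply (definable_total_op R R), radd_set. Qed.
Lemma definable_le : definable2 le.
Proof. apply definable_set_relation, rle_set. Qed.
Hint Resolve definable_add definable_le : definability.
Lemma definable_lt : definable2 lt.
Proof. unfold lt. definability. Qed.
Hint Resolve definable_lt : definability.

Lemma add_in x y : x + y ∈ R.
Proof. apply (total_op_in R R); [apply radd_set|apply rzero_in]. Qed.

Lemma add_eq x y : x ∈ R -> y ∈ R -> x + y = radd R x y.
Proof. apply total_op_eq. Qed.

Hint Resolve add_in rzero_in rone_in : reals.

Lemma le_in_l x y : x <= y -> x ∈ R. Proof. now intros (? & ? & ?). Qed.
Lemma le_in_r x y : x <= y -> y ∈ R. Proof. now intros (? & ? & ?). Qed.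
Lemma lt_in_l x y : x < y -> x ∈ R. Proof. now intros ((? & ? & ?) & ?). Qed.
Lemma lt_in_r x y : x < y -> y ∈ R. Proof. now intros ((? & ? & ?) & ?). Qed.
Hint Resolve le_in_l le_in_r lt_in_l lt_in_r : reals.

Lemma addC x y : x ∈ R -> y ∈ R -> x + y = y + x.
Proof. intros. rewrite !add_eq by auto. now apply raddC. Qed.

Lemma addA x y z : x ∈ R -> y ∈ R -> z ∈ R -> x + (y + z) = (x + y) + z.
Proof.
intros Hx Hy Hz. rewrite (add_eq x), (add_eq (x + y)) by auto using add_in.
rewrite !add_eq by auto. now apply raddA.
Qed.

Lemma add0 x : x ∈ R -> x + 0 = x.
Proof. intros. rewrite add_eq by auto with reals. now apply radd0. Qed.

Lemma addN x : x ∈ R -> exists y, y ∈ R /\ x + y = 0.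
Proof.
intros Hx. destruct (raddN Hx) as (y & Hy & E). exists y. now rewrite add_eq.
Qed.

Lemma le_refl x : x ∈ R -> x <= x.
Proof. intro Hx. repeat split; auto. now apply rle_refl. Qed.

Lemma le_trans y x z : x <= y -> y <= z -> x <= z.
Proof.
intros (Hx & Hy & H) (_ & Hz & H'). repeat split; auto. now apply (@rle_trans M R x y z).
Qed.

Lemma le_antisym x y : x <= y -> y <= x -> x = y.
Proof. intros (Hx & Hy & H) (_ & _ & H'). now apply (@rle_anti M R). Qed.

Lemma le_or_lt x y : x ∈ R -> y ∈ R -> x <= y \/ y < x.
Proof.
intros Hx Hy. destruct (rle_total Hx Hy) as [H|H]; [left; now repeat split|].
destruct (classic (y = x)) as [->|N].
- left. now apply le_refl.
- right. now repeat split.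
Qed.

Lemma lt_le x y : x < y -> x <= y. Proof. now intros []. Qed.
Hint Resolve lt_le : reals.

Lemma lt_not_le x y : x < y -> y <= x -> False.
Proof. intros [H N] H'. apply N. now apply le_antisym. Qed.

Lemma lt_le_trans y x z : x < y -> y <= z -> x < z.
Proof.
intros [H N] H'. split; [now apply (le_trans y)|]. intros ->. apply N. now apply le_antisym.
Qed.

Lemma le_lt_trans y x z : x <= y -> y < z -> x < z.
Proof.
intros H [H' N]. split; [now apply (le_trans y)|]. intros ->. apply N. now apply le_antisym.
Qed.

Lemma lt_trans y x z : x < y -> y < z -> x < z.
Proof. intros H H'. apply (lt_le_trans y); auto with reals. Qed.

Lemma not_lt_le x y : x ∈ R -> y ∈ R -> ~ x < y -> y <= x.
Proof. intros Hx Hy N. destruct (le_or_lt y x) as [|H]; tauto. Qed.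

Lemma add_le_r x y z : x <= y -> z ∈ R -> x + z <= y + z.
Proof.
intros (Hx & Hy & H) Hz. repeat split; auto with reals.
rewrite !add_eq by auto. now apply rle_add.
Qed.

Lemma add_le x y z t : x <= y -> z <= t -> x + z <= y + t.
Proof.
intros H H'. apply (le_trans (y + z)).
- apply add_le_r; eauto with reals.
- rewrite (addC y z), (addC y t) by eauto with reals. apply add_le_r; eauto with reals.
Qed.

Lemma add_le_cancel x y z : x ∈ R -> y ∈ R -> z ∈ R -> x + z <= y + z -> x <= y.
Proof.
intros Hx Hy Hz H. destruct (addN z Hz) as (n & Hn & E).
assert (G : forall u, u ∈ R -> u = (u + z) + n).
{ intros u Hu. now rewrite <- addA, E, add0 by auto. }
rewrite (G x Hx), (G y Hy). now apply add_le_r.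
Qed.

Lemma add_lt_le x y z t : x < y -> z <= t -> x + z < y + t.
Proof.
intros H H'. destruct (le_or_lt (y + t) (x + z)) as [G|]; auto with reals.
destruct (lt_not_le x y H). apply (add_le_cancel y x t); eauto with reals.
apply (le_trans (x + z)); auto. apply add_le; auto. apply le_refl. eauto with reals.
Qed.

Lemma add_lt x y z t : x < y -> z < t -> x + z < y + t.
Proof. intros H H'. apply add_lt_le; auto with reals. Qed.

Lemma lt_add_pos x y : x ∈ R -> 0 < y -> x < x + y.
Proof.
intros Hx Hy. rewrite <- (add0 x Hx) at 1. rewrite (addC x 0), (addC x y) by eauto with reals.
apply add_lt_le; auto using le_refl.
Qed.

Lemma le_add_nonneg x y : x ∈ R -> 0 <= y -> x <= x + y.
Proof.
intros Hx Hy. rewrite <- (add0 x Hx) at 1. apply add_le; auto using le_refl.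
Qed.

Lemma add_nonneg x y : 0 <= x -> 0 <= y -> 0 <= x + y.
Proof. intros Hx Hy. apply (le_trans x); [auto|]. apply le_add_nonneg; eauto with reals. Qed.

Lemma rmul_in x y : x ∈ R -> y ∈ R -> rmul R x y ∈ R.
Proof. apply (rmul_set R). Qed.

Lemma rmul0 x : x ∈ R -> rmul R x 0 = 0.
Proof.
intro Hx. assert (Hm : rmul R x 0 ∈ R) by auto using rmul_in with reals.
assert (E : rmul R x 0 + rmul R x 0 = 0 + rmul R x 0).
{ rewrite (addC 0), add0 by auto with reals.
  rewrite add_eq, <- rmulD by auto with reals. now rewrite radd0 by auto with reals. }
apply le_antisym; apply (add_le_cancel _ _ (rmul R x 0)); auto with reals;
  rewrite E; apply le_refl; auto with reals.
Qed.

(** Otherwise 1 is at most 0, so n = -1 is nonnegative, and therefore so is its square, which is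
    1. *)
Lemma lt01 : 0 < 1.
Proof.
split; [|apply not_eq_sym, rone_neq0].
destruct (le_or_lt 0 1) as [H|[H _]]; auto with reals.
destruct (addN 1 (rone_in R)) as (n & Hn & E).
assert (H' : 0 <= n).
{ pose proof (add_le_r 1 0 n H Hn) as G.
  now rewrite E, (addC 0 n), add0 in G by auto with reals. }
assert (Hnn : rmul R n n = 1).
{ assert (G : 1 + n = rmul R n n + n).
  { rewrite E, <- (rmul0 n Hn), <- E.
    rewrite add_eq, rmulD, rmul1 by auto with reals.
    rewrite add_eq, raddC by auto using rmul_in with reals. reflexivity. }
  apply le_antisym; apply (add_le_cancel _ _ n); auto using rmul_in with reals;
    rewrite G; apply le_refl; auto with reals. }
rewrite <- Hnn. repeat split; auto using rmul_in with reals.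
destruct H' as (_ & _ & H'). now apply rle_mul.
Qed.

Lemma half_ex x : x ∈ R -> exists h, h ∈ R /\ h + h = x.
Proof.
intro Hx.
assert (H2 : 1 + 1 <> 0).
{ intro E. apply (lt_not_le 0 1 lt01). rewrite <- E.
  apply le_add_nonneg; auto using lt01 with reals. }
destruct (rmulV (add_in 1 1) H2) as (v & Hv & E).
exists (rmul R x v). split; [now apply rmul_in|].
assert (Hxv : rmul R x v ∈ R) by now apply rmul_in.
rewrite add_eq by auto. rewrite <- (rmul1 Hxv) at 1 2.
rewrite <- rmulD, <- add_eq by auto with reals.
rewrite <- rmulA, (rmulC Hv), E by auto with reals. now apply rmul1.
Qed.

Lemma half_pos h x : h ∈ R -> h + h = x -> 0 < x -> 0 < h.
Proof.
intros Hh E Hx. destruct (le_or_lt h 0) as [H|]; auto with reals.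
destruct (lt_not_le 0 x Hx). rewrite <- E, <- (add0 0) by auto with reals. now apply add_le.
Qed.

Lemma double_le_cancel x y : x ∈ R -> y ∈ R -> x + x <= y + y -> x <= y.
Proof.
intros Hx Hy H. destruct (le_or_lt x y) as [|H']; auto.
destruct (lt_not_le (y + y) (x + x)); auto using add_lt.
Qed.

Lemma half_pos_ex x : 0 < x -> exists h, 0 < h /\ h + h = x.
Proof.
intro Hx. destruct (half_ex x) as (h & Hh & E); eauto with reals.
exists h. split; [now apply (half_pos h x)|exact E].
Qed.

Lemma min_pos_ex x y : 0 < x -> 0 < y -> exists z, 0 < z /\ z <= x /\ z <= y.
Proof.
intros Hx Hy. destruct (le_or_lt x y) as [H|H]; eauto with reals.
- exists x. repeat split; try apply Hx; try apply H; apply le_refl; eauto with reals.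
- exists y. split; [|split]; auto with reals. apply le_refl; eauto with reals.
Qed.

Lemma sup_ex (C : M -> Prop) b : definable1 C -> (exists c, c ∈ R /\ C c) ->
  b ∈ R -> (forall c, c ∈ R -> C c -> c <= b) ->
  exists s, s ∈ R /\ (forall c, c ∈ R -> C c -> c <= s) /\
    (forall b, b ∈ R -> (forall c, c ∈ R -> C c -> c <= b) -> s <= b).
Proof.
intros HC (c & Hc & HCc) Hb Hub. destruct (separation C R HC) as [S HS].
destruct (@rle_complete M R S) as (s & Hs & H1 & H2).
- intros x Hx. now apply HS.
- exists c. now apply HS.
- exists b. split; [exact Hb|]. intros x Hx. apply Hub; now apply HS.
- exists s. split; [exact Hs|]. split.
  + intros x Hx HCx. repeat split; auto. apply H1, HS. auto.
  + intros x Hx Hub'. repeat split; auto. apply H2; auto.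
    intros y Hy. apply Hub'; now apply HS.
Qed.

Definition is_inf (C : M -> Prop) r : Prop :=
  r ∈ R /\ (forall c, c ∈ R -> C c -> r <= c) /\
  (forall b, b ∈ R -> (forall c, c ∈ R -> C c -> b <= c) -> b <= r).

Lemma inf_ex (C : M -> Prop) l : definable1 C -> (exists c, c ∈ R /\ C c) ->
  l ∈ R -> (forall c, c ∈ R -> C c -> l <= c) -> exists r, is_inf C r.
Proof.
intros HC (c & Hc & HCc) Hl Hlb.
destruct (sup_ex (fun b => forall c, c ∈ R -> C c -> b <= c) c) as (s & Hs & H1 & H2);
  eauto.
- definability.
- exists s. split; [exact Hs|]. split; auto.
Qed.

Lemma is_inf_lt C r x : is_inf C r -> r < x -> exists c, c ∈ R /\ C c /\ c < x.
Proof.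
intros (Hr & _ & H) Hx. apply NNPP. intro N. apply (lt_not_le r x Hx).
apply H; eauto with reals. intros c Hc HCc. apply not_lt_le; eauto with reals.
intro Hcx. apply N. now exists c.
Qed.

Lemma is_inf_unique C r r' : is_inf C r -> is_inf C r' -> r = r'.
Proof. intros (H1 & H2 & H3) (H1' & H2' & H3'). apply le_antisym; auto. Qed.

Lemma sub_ex x y : x ∈ R -> y ∈ R -> exists z, z ∈ R /\ z + y = x.
Proof.
intros Hx Hy. destruct (addN y Hy) as (n & Hn & E). exists (x + n).
split; [apply add_in|]. now rewrite <- addA, (addC n), E, add0 by auto.
Qed.

(** The bound passes to one infimum at a time: first [r'] is subtracted from [x], then an arbitrary
    [c] of [C]. *)
Lemma is_inf_add C D r r' x : is_inf C r -> is_inf D r' -> x ∈ R ->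
  (forall c c', c ∈ R -> c' ∈ R -> C c -> D c' -> x <= c + c') -> x <= r + r'.
Proof.
intros (Hr & _ & H) (Hr' & _ & H') Hx Hle.
destruct (sub_ex x r' Hx Hr') as (z & Hz & <-).
apply add_le_r; auto. apply H; auto. intros c Hc HCc.
apply (add_le_cancel z c r'); auto.
destruct (sub_ex (z + r') c) as (z' & Hz' & E); auto with reals.
rewrite <- E, (addC c) by auto. apply add_le_r; auto.
apply H'; auto. intros c' Hc' HDc'. apply (add_le_cancel z' c' c); auto.
rewrite E, (addC c') by auto. auto.
Qed.

(* Because the infimum [i] of [C] satisfies [i + i <= i]. *)
Lemma small_of_halving (C : M -> Prop) : definable1 C -> (exists c, c ∈ R /\ C c) ->
  (forall c, c ∈ R -> C c -> 0 <= c /\ exists c', c' ∈ R /\ C c' /\ c' + c' <= c) ->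
  forall x, 0 < x -> exists c, c ∈ R /\ C c /\ c < x.
Proof.
intros HC Hne H x Hx. destruct (inf_ex C 0 HC Hne) as [r Hr]; auto with reals.
{ intros c Hc HCc. now apply H. }
apply (is_inf_lt C r x Hr). apply (le_lt_trans 0); auto.
destruct Hr as (Hr & H1 & H2). apply (add_le_cancel r 0 r); auto with reals.
rewrite (addC 0 r), add0 by auto with reals. apply H2; auto with reals.
intros c Hc HCc. destruct (H c Hc HCc) as (_ & c' & Hc' & HCc' & Hle).
apply (le_trans (c' + c')); auto. apply add_le; auto.
Qed.

(** If all of [C] stayed below [x], its supremum [s] would satisfy s + m <= s. This replaces an
    induction on the number of steps of length [m] below [x]. *)
Lemma archimedean_ind (C : M -> Prop) m : definable1 C -> 0 < m -> C 0 ->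
  (forall c, c ∈ R -> C c -> C (c + m)) ->
  forall x, x ∈ R -> exists c, c ∈ R /\ C c /\ x <= c.
Proof.
intros HC Hm H0 HS x Hx. apply NNPP. intro N.
destruct (sup_ex C x HC) as (s & Hs & H1 & H2); eauto with reals.
{ intros c Hc HCc. destruct (le_or_lt c x) as [|H]; auto. destruct N. exists c.
  auto with reals. }
destruct (addN m) as (n & Hn & E); eauto with reals.
assert (G : s <= s + n).
{ apply H2; auto with reals. intros c Hc HCc.
  apply (add_le_cancel c (s + n) m); eauto with reals.
  rewrite <- addA, (addC n), E, add0 by eauto with reals. auto with reals. }
assert (G' : s + m <= s).
{ rewrite <- (add0 s Hs) at 2. rewrite <- E, (addC m), addA by eauto with reals.
  apply add_le_r; eauto with reals. }
exact (lt_not_le _ _ (lt_add_pos s m Hs Hm) G').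
Qed.

Lemma rlt_lt x y : x ∈ R -> y ∈ R -> (rlt R x y <-> x < y).
Proof. unfold rlt, lt, le. tauto. Qed.

(** * Topologies of quasi-metrics *)

Section NegPow2.
Variables (w : M) (p : M -> M).
Hypotheses (w_omega : is_omega w) (p_fun : set_function w R p).
Hypothesis p0 : forall z, z ∈ w -> is_empty z -> p z = 1.
Hypothesis pS : forall k m, k ∈ w -> m ∈ w -> is_succ k m -> radd R (p m) (p m) = p k.

Lemma neg_pow2_in k : k ∈ w -> p k ∈ R.
Proof. apply p_fun. Qed.

Lemma neg_pow2_succ k : k ∈ w -> exists m, m ∈ w /\ p m + p m = p k.
Proof.
intro Hk. destruct w_omega as [[_ Hw] _]. destruct (Hw k Hk) as (m & Hm & Hmw).
exists m. split; [exact Hmw|]. rewrite add_eq by now apply neg_pow2_in. now apply pS.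
Qed.

Lemma neg_pow2_pos k : k ∈ w -> 0 < p k.
Proof.
pose proof (definable_total_fun w R 0 p p_fun) as Hp.
intro Hk. rewrite <- (total_fun_eq w 0 p k Hk). revert Hk.
(* The base case of [omega_ind] does not provide membership in [w], so membership is made part of
   the induction predicate. *)
enough (G : k ∈ w -> k ∈ w -> 0 < total_fun w 0 p k) by auto.
apply (omega_ind w (fun k => k ∈ w -> 0 < total_fun w 0 p k) w_omega).
- definability.
- intros z Hz Hzw. rewrite total_fun_eq, p0 by auto. apply lt01.
- intros i m Hi Hm Hs IH _. specialize (IH Hi). rewrite total_fun_eq in IH |- * by auto.
  apply (half_pos (p m) (p i)); auto using neg_pow2_in.
  rewrite add_eq by now apply neg_pow2_in. now apply pS.
Qed.

(** The values of [p] are positive and closed under halving, so [small_of_halving] applies. *)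
Lemma neg_pow2_small x : 0 < x -> exists k, k ∈ w /\ p k < x.
Proof.
pose proof (definable_total_fun w R 0 p p_fun) as Hp.
intro Hx.
destruct (small_of_halving (fun c => exists k, k ∈ w /\ c = total_fun w 0 p k))
  with (x := x) as (c & _ & (k & Hk & ->) & H); auto.
- definability.
- destruct w_omega as [[(z & Hz & Hzw) _] _]. exists (p z).
  split; [now apply neg_pow2_in|]. exists z. now rewrite total_fun_eq.
- intros c Hc (k & Hk & ->). rewrite total_fun_eq by auto.
  split; [apply lt_le, neg_pow2_pos; auto|].
  destruct (neg_pow2_succ k Hk) as (m & Hm & E). exists (p m).
  split; [now apply neg_pow2_in|]. split.
  + exists m. now rewrite total_fun_eq.
  + rewrite E. now apply le_refl, neg_pow2_in.
- exists k. split; [exact Hk|]. now rewrite total_fun_eq in H.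
Qed.

End NegPow2.

(** The topology [tau] with arbitrary positive radii in place of the numbers 2^(-n). *)
Definition eps_open X (d : M -> M -> M) V : Prop :=
  is_subset V X /\ forall x, x ∈ V ->
    exists r, 0 < r /\ forall y, y ∈ X -> d x y < r -> y ∈ V.

(** Radii in [tau] presuppose a sequence 2^(-n) in the model; its existence is the premise for
    passing from real radii back to [tau]. *)
Definition has_neg_pow2 : Prop :=
  exists w n r, is_omega w /\ n ∈ w /\ is_neg_pow2 R w n r.

Lemma tau_eps_open X d V : (forall x y, x ∈ X -> y ∈ X -> d x y ∈ R) ->
  tau R X d V -> eps_open X d V.
Proof.
intros d_in [HV H]. split; [exact HV|]. intros x Hx.
destruct (H x Hx) as (w & n & r & Hw & Hn & (p & Hp & p0 & pS & <-) & Hr).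
assert (Hpn : 0 < p n) by now apply (neg_pow2_pos w).
exists (p n). split; [exact Hpn|]. intros y Hy Hxy. apply Hr. split; [exact Hy|].
apply rlt_lt; eauto with reals.
Qed.

Lemma eps_open_tau X d V : has_neg_pow2 -> (forall x y, x ∈ X -> y ∈ X -> d x y ∈ R) ->
  eps_open X d V -> tau R X d V.
Proof.
intros (w & n & q & Hw & Hn & (p & Hp & p0 & pS & _)) d_in [HV H].
split; [exact HV|]. intros x Hx. destruct (H x Hx) as (r & Hr & Hball).
destruct (neg_pow2_small w p Hw Hp p0 pS r Hr) as (k & Hk & Hkr).
exists w, k, (p k). split; [exact Hw|]. split; [exact Hk|].
split; [now exists p|]. intros y [Hy Hxy]. apply Hball; [exact Hy|].
apply (lt_trans (p k)); [|exact Hkr]. apply rlt_lt; eauto with reals.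
Qed.

(** Induction along an enumeration of [F], taking the smaller of two radii at each step. Only the
    existence of a common radius is carried along, so no family of radii is chosen. *)
Lemma finite_uniform F (P : M -> M -> Prop) : is_finite F -> definable2 P ->
  (forall x r r', 0 < r' -> r' <= r -> P x r -> P x r') ->
  (forall x, x ∈ F -> exists r, 0 < r /\ P x r) ->
  exists r, 0 < r /\ forall x, x ∈ F -> P x r.
Proof.
intros (w & n & f & Hw & Hn & Hf & _ & Hsurj) HP Hmono H.
pose proof (definable_total_fun n F n f Hf) as Hdef.
(* The induction runs through all of [w], also beyond [n], where the condition k ∈ n makes the new
   index harmless; the result is read off at [n] itself. *)
enough (G : exists r, 0 < r /\ forall k, k ∈ n -> k ∈ n -> P (total_fun n n f k) r).
{ destruct G as (r & Hr & G). exists r. split; [exact Hr|]. intros x Hx.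
  destruct (Hsurj x Hx) as (k & Hk & <-). specialize (G k Hk Hk).
  now rewrite total_fun_eq in G. }
apply (omega_ind w (fun m => exists r, 0 < r /\
  forall k, k ∈ m -> k ∈ n -> P (total_fun n n f k) r) Hw); auto.
- definability.
- intros z Hz. exists 1. split; [exact lt01|]. intros k Hk. destruct (Hz k Hk).
- intros m m' Hm Hm' Hs (r & Hr & IH).
  destruct (classic (m ∈ n)) as [Hmn|Hmn].
  + destruct (H (f m)) as (r' & Hr' & HPr'); [now apply Hf|].
    destruct (min_pos_ex r r' Hr Hr') as (s & Hs0 & Hsr & Hsr').
    exists s. split; [exact Hs0|]. intros k Hk Hkn. apply Hs in Hk. destruct Hk as [Hk | ->].
    * apply (Hmono _ r); auto.
    * rewrite total_fun_eq by auto. apply (Hmono _ r'); auto.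
  + exists r. split; [exact Hr|]. intros k Hk Hkn. apply Hs in Hk.
    destruct Hk as [Hk | ->]; [auto|contradiction].
Qed.

(** * The uniformity of a compact Hausdorff quasi-metric space *)

Section Space.
Variables (X : M) (d : M -> M -> M).
Hypothesis definable_d : definable_op d.
Hint Resolve definable_d : definability.
Hypothesis d_in : forall x y, d x y ∈ R.
Hypothesis d_nonneg : forall x y, x ∈ X -> y ∈ X -> 0 <= d x y.
Hypothesis d_triangle : forall x y z, x ∈ X -> y ∈ X -> z ∈ X -> d x y <= d x z + d z y.
Hypothesis d_eq0 : forall x y, x ∈ X -> y ∈ X -> (d x y = 0 <-> x = y).
Hypothesis d_compact : is_compact X (eps_open X d).
Hypothesis d_hausdorff : is_hausdorff X (eps_open X d).
Hint Resolve d_in : reals.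

Lemma d_refl_lt x r : x ∈ X -> 0 < r -> d x x < r.
Proof. intros Hx Hr. now rewrite (proj2 (d_eq0 x x Hx Hx) eq_refl). Qed.

Lemma d_pos x y : x ∈ X -> y ∈ X -> x <> y -> 0 < d x y.
Proof. intros Hx Hy N. split; [auto|]. intro E. apply N, d_eq0; auto. Qed.

Lemma d_lt_add x y z r s t : x ∈ X -> y ∈ X -> z ∈ X ->
  d x z < r -> d z y < s -> r + s <= t -> d x y < t.
Proof.
intros Hx Hy Hz Hr Hs Ht. apply (le_lt_trans (d x z + d z y)); auto.
apply (lt_le_trans (r + s)); auto. now apply add_lt.
Qed.

Lemma ball_ex x r : x ∈ X -> 0 < r ->
  exists V, eps_open X d V /\ x ∈ V /\ forall y, y ∈ V <-> y ∈ X /\ d x y < r.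
Proof.
intros Hx Hr. destruct (separation (fun y => d x y < r) X) as [V HV]; [definability|].
exists V. split; [|split]; auto.
- split; [intros y Hy; now apply HV|]. intros y Hy. apply HV in Hy. destruct Hy as [Hy Hxy].
  (* Here n = -d(x, y), so the radius used around [y] is r - d(x, y). *)
  destruct (addN (d x y)) as (n & Hn & E); auto.
  assert (E' : d x y + (r + n) = r).
  { rewrite addA, (addC (d x y)), <- addA, E, add0 by eauto with reals. reflexivity. }
  exists (r + n). split.
  + rewrite <- E. apply add_lt_le; auto using le_refl.
  + intros z Hz Hyz. apply HV. split; [exact Hz|].
    apply (le_lt_trans (d x y + d y z)); auto.
    rewrite <- E', (addC (d x y)), (addC (d x y)) by auto with reals.
    apply add_lt_le; auto using le_refl.
- apply HV. split; [exact Hx|]. now apply d_refl_lt.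
Qed.

(** The cover consists of all open sets on which a single [r] works, so no radius is chosen for a
    point; [finite_uniform] treats a finite subcover. *)
Lemma local_uniform (G : M -> M -> Prop) : definable2 G ->
  (forall x r r', 0 < r' -> r' <= r -> G r x -> G r' x) ->
  (forall x, x ∈ X -> exists r, 0 < r /\ forall y, y ∈ X -> d x y < r -> G r y) ->
  exists r, 0 < r /\ forall x, x ∈ X -> G r x.
Proof.
intros HG Hmono Hloc. destruct (zf_power zfM X) as [PX HPX].
destruct (separation (fun V => eps_open X d V /\
  exists r, 0 < r /\ forall x, x ∈ V -> G r x) PX) as [U HU].
{ unfold eps_open, is_subset. definability. }
destruct (d_compact U) as (F & HFU & HF & Hcov).
- intros V HV. now apply HU in HV.
- intros x Hx. destruct (Hloc x Hx) as (r & Hr & H).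
  destruct (ball_ex x r Hx Hr) as (V & HVo & HxV & HV).
  exists V. split; [|exact HxV]. apply HU. split; [apply HPX, HVo|]. split; [exact HVo|].
  exists r. split; [exact Hr|]. intros y Hy. apply HV in Hy. now apply H.
- destruct (finite_uniform F (fun V r => forall x, x ∈ V -> G r x)) as (r & Hr & H); auto.
  + definability.
  + intros V r r' Hr' Hle H x Hx. apply (Hmono x r); auto.
  + intros V HV. now apply HU, HFU.
  + exists r. split; [exact Hr|]. intros x Hx. destruct (Hcov x Hx) as (V & HV & HxV).
    now apply (H V).
Qed.

Definition near r x y : Prop := exists u, u ∈ X /\ d u x < r /\ d u y < r.

Lemma near_sym r x y : near r x y -> near r y x.
Proof. intros (u & Hu & H & H'). now exists u. Qed.

Lemma near_refl r x : x ∈ X -> 0 < r -> near r x x.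
Proof. intros Hx Hr. exists x. auto using d_refl_lt. Qed.

Lemma near_mono r s x y : r <= s -> near r x y -> near s x y.
Proof.
intros Hrs (u & Hu & H & H'). exists u. split; [exact Hu|].
split; [now apply (lt_le_trans r _ _ H)|now apply (lt_le_trans r _ _ H')].
Qed.

(** For fixed [y] the property is local in [u]. Around [y] it is the triangle inequality through
    [u]; around any other point it holds vacuously, because [y'] would lie in two disjoint open
    sets. The extra point [y'] lets the lemma serve [near_comp] as well as [near_in_ball]. *)
Lemma star_in_ball y e : y ∈ X -> 0 < e -> exists r, 0 < r /\
  forall u x y', u ∈ X -> x ∈ X -> y' ∈ X ->
    d u x < r -> d u y' < r -> d y y' < r -> d y x < e.
Proof.
intros Hy He.
destruct (local_uniform (fun r u => forall x y', x ∈ X -> y' ∈ X ->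
  d u x < r -> d u y' < r -> d y y' < r -> d y x < e)) as (r & Hr & H).
- definability.
- intros u r r' _ Hle H x y' Hx Hy' H1 H2 H3.
  apply (H x y'); auto; now apply (lt_le_trans r').
- intros p Hp. destruct (classic (p = y)) as [->|N].
  + destruct (half_pos_ex e He) as (r & Hr & E). exists r. split; [exact Hr|].
    intros u Hu Hyu x y' Hx _ Hux _ _. apply (d_lt_add y x u r r); auto.
    rewrite E. apply le_refl. eauto with reals.
  + destruct (d_hausdorff p y Hp Hy N) as (A & B & [_ HA] & [_ HB] & HpA & HyB & Hdisj).
    destruct (HA p HpA) as (rA & HrA & HA'), (HB y HyB) as (rB & HrB & HB').
    (* The point [y'] is reached from [p] through [u], in two steps shorter than half of [rA]. *)
    destruct (half_pos_ex rA HrA) as (h & Hh & E).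
    destruct (min_pos_ex h rB Hh HrB) as (r & Hr & Hrh & HrB').
    exists r. split; [exact Hr|]. intros u Hu Hpu x y' _ Hy' _ Huy' Hyy'.
    destruct (Hdisj y'). split.
    * apply HA'; auto. apply (d_lt_add p y' u r r); auto. rewrite <- E. now apply add_le.
    * apply HB'; auto. now apply (lt_le_trans r).
- exists r. split; [exact Hr|]. eauto.
Qed.

Lemma near_in_ball x e : x ∈ X -> 0 < e -> exists r, 0 < r /\
  forall y, y ∈ X -> near r x y -> d x y < e.
Proof.
intros Hx He. destruct (star_in_ball x e Hx He) as (r & Hr & H).
exists r. split; [exact Hr|]. intros y Hy (u & Hu & Hux & Huy).
apply (H u y x); auto. now apply d_refl_lt.
Qed.

(** The property is local in the middle point: for [y] in a small ball around [p], [star_in_ball]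
    puts [x] and [z] in the [e]-ball of [p], so [p] witnesses their nearness. *)
Lemma near_comp e : 0 < e -> exists r, 0 < r /\
  forall x y z, x ∈ X -> y ∈ X -> z ∈ X -> near r x y -> near r y z -> near e x z.
Proof.
intros He.
destruct (local_uniform (fun r y => forall x z, x ∈ X -> z ∈ X ->
  near r x y -> near r y z -> near e x z)) as (r & Hr & H).
- unfold near. definability.
- intros y r r' _ Hle H x z Hx Hz H1 H2.
  apply H; auto; now apply (near_mono r').
- intros p Hp. destruct (star_in_ball p e Hp He) as (r & Hr & H).
  exists r. split; [exact Hr|].
  intros y Hy Hpy x z Hx Hz (u & Hu & Hux & Huy) (v & Hv & Hvy & Hvz).
  exists p. split; [exact Hp|]. split; [now apply (H u x y)|now apply (H v z y)].
- exists r. split; [exact Hr|]. eauto.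
Qed.

(** Threefold composition is the form used by Frink's lemma; halving keeps each scale below its
    label 2^(-n). *)
Definition refines r e : Prop :=
  0 < r /\ r + r <= e /\ forall x y z t, x ∈ X -> y ∈ X -> z ∈ X -> t ∈ X ->
    near r x y -> near r y z -> near r z t -> near e x t.

Lemma refines_ex e : 0 < e -> exists r, refines r e.
Proof.
intro He. destruct (near_comp e He) as (r1 & Hr1 & H1), (near_comp r1 Hr1) as (r2 & Hr2 & H2).
destruct (half_pos_ex e He) as (h & Hh & E).
destruct (min_pos_ex r1 r2 Hr1 Hr2) as (r3 & Hr3 & H31 & H32).
destruct (min_pos_ex h r3 Hh Hr3) as (r & Hr & Hrh & Hr3').
assert (Hr1' : r <= r1) by now apply (le_trans r3).
assert (Hr2' : r <= r2) by now apply (le_trans r3).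
exists r. split; [exact Hr|]. split; [rewrite <- E; now apply add_le|].
intros x y z t Hx Hy Hz Ht Hxy Hyz Hzt. apply (H1 x z t); auto.
- apply (H2 x y z); auto; now apply (near_mono r).
- now apply (near_mono r).
Qed.

(** * The chain metric *)

(* A sequence of scales e_n with e_(n+1) refining e_n, labelled by q = 2^(-n). No
   successor is chosen: every admissible e is kept at each level. *)
Definition scale : M -> M -> Prop :=
  reach R R (fun q e => q = 1 /\ e = 1)
    (fun q e q' e' => q' + q' = q /\ refines e' e).

Lemma definable_scale : definable2 scale.
Proof. unfold scale, reach, refines, near. definability. Qed.
Hint Resolve definable_scale : definability.

Lemma scale_in q e : scale q e -> q ∈ R /\ e ∈ R.
Proof. intros (Hq & He & _). auto. Qed.

Lemma scale_bounds q e : scale q e -> 0 < e /\ e <= q.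
Proof.
apply (reach_ind R R (fun q e => q = 1 /\ e = 1)
  (fun q e q' e' => q' + q' = q /\ refines e' e) (fun q e => 0 < e /\ e <= q));
  [exact definable_scale|definability| |].
- intros x y _ _ [-> ->]. auto using lt01, le_refl with reals.
- intros q0 e0 q' e' _ _ Hq' He' _ [_ H] [<- (Hpos & Hle & _)].
  split; [exact Hpos|]. apply double_le_cancel; auto. now apply (le_trans e0).
Qed.

Lemma scale_inv q e : scale q e ->
  q = 1 \/ exists q' e', scale q' e' /\ q + q = q' /\ refines e e'.
Proof.
apply (reach_ind R R (fun q e => q = 1 /\ e = 1)
  (fun q e q' e' => q' + q' = q /\ refines e' e)
  (fun q e => q = 1 \/ exists q' e', scale q' e' /\ q + q = q' /\ refines e e'));
  [exact definable_scale|unfold refines, near; definability| |].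
- intros x y _ _ [-> _]. auto.
- intros q0 e0 q' e' _ _ _ _ Hs _ [E H]. right. now exists q0, e0.
Qed.

Lemma scale_small x : 0 < x -> exists q e, scale q e /\ q < x.
Proof.
intro Hx.
destruct (small_of_halving (fun q => exists e, scale q e)) with (x := x)
  as (q & _ & (e & H) & Hlt); auto.
- definability.
- exists 1. split; [auto with reals|]. exists 1. apply reach_init; auto with reals.
- intros q Hq [e H]. destruct (scale_bounds q e H) as [Hpos Hle].
  split; [apply (le_trans e); auto with reals|].
  destruct (half_ex q Hq) as (h & Hh & E), (refines_ex e Hpos) as (r & Hr).
  exists h. split; [exact Hh|]. split.
  + exists r. apply (reach_step R R _ _ q e); auto.
    destruct Hr. eauto with reals.
  + rewrite E. now apply le_refl.
- now exists q, e.
Qed.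

(** Weights of at least 2 admit every pair, so that any two points are joined by a chain. The
    threshold is twice the top label 1, which has no predecessor to absorb a composition. *)
Definition entourage q x y : Prop :=
  1 + 1 <= q \/ exists q' e, scale q' e /\ q' <= q /\ near e x y.

Lemma entourage_mono q r x y : q <= r -> entourage q x y -> entourage r x y.
Proof.
intros Hqr [H | (q' & e & Hs & Hle & H)].
- left. now apply (le_trans q).
- right. exists q', e. split; [exact Hs|]. split; [now apply (le_trans q)|exact H].
Qed.

Lemma entourage_sym q x y : entourage q x y -> entourage q y x.
Proof.
intros [H | (q' & e & Hs & Hle & H)]; [now left|].
right. exists q', e. auto using near_sym.
Qed.

Lemma entourage_of_near q : 0 < q -> exists e, 0 < e /\
  forall x y, near e x y -> entourage q x y.
Proof.
intro Hq. destruct (scale_small q Hq) as (q' & e & Hs & Hlt).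
exists e. split; [now apply (scale_bounds q')|]. intros x y H.
right. exists q', e. auto with reals.
Qed.

Lemma entourage_refl q x : x ∈ X -> 0 < q -> entourage q x x.
Proof.
intros Hx Hq. destruct (entourage_of_near q Hq) as (e & He & H).
apply H. now apply near_refl.
Qed.

Lemma near_of_entourage q x y : q <= 1 -> entourage q x y -> near q x y.
Proof.
intros Hq [H | (q' & e & Hs & Hle & H)].
- destruct (lt_not_le 1 (1 + 1)); [|now apply (le_trans q)].
  apply lt_add_pos; auto using lt01 with reals.
- apply (near_mono e); auto. apply (le_trans q'); auto. now apply scale_bounds.
Qed.

(** Edges may come from unrelated branches of [scale]; the larger of the two reals [e] still gives
    one scale that serves both. *)
Lemma scale_max q q1 e1 q2 e2 : scale q1 e1 -> q1 <= q -> scale q2 e2 -> q2 <= q ->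
  exists q' e, scale q' e /\ q' <= q /\ e1 <= e /\ e2 <= e.
Proof.
intros H1 L1 H2 L2. destruct (scale_in q1 e1 H1) as [_ He1], (scale_in q2 e2 H2) as [_ He2].
destruct (le_or_lt e1 e2) as [H|H]; auto.
- exists q2, e2. auto using le_refl.
- exists q1, e1. auto using le_refl, lt_le.
Qed.

(** When r < 2, the inequality q + q <= r forces q < 1. A scale common to the three steps then has a
    predecessor with doubled label, which absorbs their composition. *)
Lemma entourage_comp q r x y z t : x ∈ X -> y ∈ X -> z ∈ X -> t ∈ X ->
  entourage q x y -> entourage q y z -> entourage q z t -> q + q <= r ->
  q ∈ R -> entourage r x t.
Proof.
intros Hx Hy Hz Ht Hxy Hyz Hzt Hqr Hq.
destruct (le_or_lt (1 + 1) r) as [|Hr]; eauto with reals; [now left|].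
assert (Hq1 : 1 <= q -> False).
{ intro H. apply (lt_not_le _ _ Hr). apply (le_trans (q + q)); auto. now apply add_le. }
assert (Hq2 : 1 + 1 <= q -> False).
{ intro H. apply Hq1. apply (le_trans (1 + 1)); auto.
  apply le_add_nonneg; auto using lt01 with reals. }
destruct Hxy as [|(q1 & e1 & S1 & L1 & N1)]; [tauto|].
destruct Hyz as [|(q2 & e2 & S2 & L2 & N2)]; [tauto|].
destruct Hzt as [|(q3 & e3 & S3 & L3 & N3)]; [tauto|].
destruct (scale_max q q1 e1 q2 e2) as (q4 & e4 & S4 & L4 & H14 & H24); auto.
destruct (scale_max q q4 e4 q3 e3) as (q0 & e0 & S0 & L0 & H40 & H30); auto.
destruct (scale_inv q0 e0 S0) as [-> | (q' & e' & S' & <- & _ & _ & H)]; [tauto|].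
right. exists (q0 + q0), e'. split; [exact S'|]. split.
- apply (le_trans (q + q)); auto. now apply add_le.
- apply (H x y z t); auto.
  + apply (near_mono e1); auto. now apply (le_trans e4).
  + apply (near_mono e2); auto. now apply (le_trans e4).
  + now apply (near_mono e3).
Qed.

(* [s] is the total weight of a finite chain from [x] to [y] whose edges
   (of weight [w] inside [entourage w]) all weigh at least [m]. *)
Definition chain m x : M -> M -> Prop :=
  reach X R (fun y s => y = x /\ s = 0)
    (fun y s z t => exists w, m <= w /\ entourage w y z /\ t = s + w).

Lemma definable_chain m x : definable2 (chain m x).
Proof. unfold chain, reach, entourage, near. definability. Qed.

Section Chains.
Variable m : M.
Hypothesis m_pos : 0 < m.

Lemma chain_ind (x : M) (P : M -> M -> Prop) : definable2 P -> (x ∈ X -> P x 0) ->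
  (forall y s z w, y ∈ X -> s ∈ R -> z ∈ X -> w ∈ R -> chain m x y s -> P y s ->
     m <= w -> entourage w y z -> P z (s + w)) ->
  forall y s, chain m x y s -> P y s.
Proof.
intros HP H0 HS. apply reach_ind; auto.
- apply definable_chain.
- intros y s Hy _ [-> ->]. auto.
- intros y s z t Hy Hs Hz _ Hc HPy (w & Hw & He & ->).
  apply (HS y s z w); eauto with reals.
Qed.

Lemma chain_in x y s : chain m x y s -> y ∈ X /\ s ∈ R.
Proof. intros (Hy & Hs & _). auto. Qed.

Lemma chain_refl x : x ∈ X -> chain m x x 0.
Proof. intro Hx. apply reach_init; auto with reals. Qed.

Lemma chain_edge x y s z w : chain m x y s -> z ∈ X -> m <= w -> entourage w y z ->
  chain m x z (s + w).
Proof.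
intros Hc Hz Hw He. apply (reach_step _ _ _ _ y s); auto with reals. now exists w.
Qed.

Lemma chain_single x y w : x ∈ X -> y ∈ X -> m <= w -> entourage w x y -> chain m x y w.
Proof.
intros Hx Hy Hw He. rewrite <- (add0 w), addC by eauto with reals.
apply (chain_edge x x); auto. now apply chain_refl.
Qed.

Lemma chain_nonneg x y s : chain m x y s -> 0 <= s /\ (s <= 0 -> y = x).
Proof.
apply (chain_ind x (fun y s => 0 <= s /\ (s <= 0 -> y = x))); [definability| |].
- auto using le_refl with reals.
- intros y0 s0 z w _ Hs _ _ _ [H _] Hw _.
  assert (Hw0 : 0 < w) by now apply (lt_le_trans m).
  split; [now apply add_nonneg; auto with reals|].
  intro Hle. destruct (lt_not_le 0 (s0 + w)); auto.
  apply (le_lt_trans s0); auto. now apply lt_add_pos.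
Qed.

Lemma chain_trans x y s z t : chain m x y s -> chain m y z t -> chain m x z (s + t).
Proof.
intros Hc. destruct (chain_in x y s Hc) as [_ Hs].
apply (chain_ind y (fun z t => chain m x z (s + t))).
- pose proof (definable_chain m x). definability.
- intros _. now rewrite add0.
- intros y0 s0 z0 w _ Hs0 Hz0 Hw _ H Hmw He. rewrite addA by auto.
  now apply (chain_edge x y0).
Qed.

Lemma chain_sym x y s : x ∈ X -> chain m x y s -> chain m y x s.
Proof.
intro Hx. apply (chain_ind x (fun y s => chain m y x s)).
- unfold chain, reach, entourage, near. definability.
- apply chain_refl.
- intros y0 s0 z w Hy0 Hs0 Hz Hw _ H Hmw He. rewrite addC by auto.
  apply (chain_trans z y0); auto. apply chain_single; auto. now apply entourage_sym.
Qed.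

(** Induction on the last edge: either this edge carries the weight past [t], or the crossing edge
    occurs earlier and the last edge prolongs the final part. *)
Lemma chain_split x y s t : t ∈ R -> 0 <= t -> chain m x y s -> t < s ->
  exists x' y' a w b, y' ∈ X /\ chain m x x' a /\ a <= t /\ t < a + w /\ m <= w /\
    entourage w x' y' /\ chain m y' y b /\ s = (a + w) + b.
Proof.
intros Ht Ht0. apply (chain_ind x (fun y s => t < s ->
  exists x' y' a w b, y' ∈ X /\ chain m x x' a /\ a <= t /\ t < a + w /\ m <= w /\
    entourage w x' y' /\ chain m y' y b /\ s = (a + w) + b)).
- unfold chain, reach, entourage, near. definability.
- intros _ H. destruct (lt_not_le _ _ H Ht0).
- intros y0 s0 z w _ Hs0 Hz Hw Hc IH Hmw He Hlt.
  destruct (le_or_lt s0 t Hs0 Ht) as [Hle|Hlt'].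
  + exists y0, z, s0, w, 0. rewrite add0 by auto with reals.
    do 6 (split; [now auto using chain_refl|]). split; auto using chain_refl.
  + destruct (IH Hlt') as (x' & y' & a & v & b & Hy' & Ha & Hat & Hta & Hv & Hev & Hb & E).
    exists x', y', a, v, (b + w). do 6 (split; [assumption|]). split.
    * now apply (chain_edge y' y0).
    * rewrite E, addA; auto with reals. apply (chain_in y' y0 b Hb).
Qed.

(* Frink's chain argument: split a chain of weight [s] at [s / 2], so that both
   outer parts weigh at most [s / 2] and at least [m] less than [s]. *)
Lemma chain_entourage x y s q : x ∈ X -> chain m x y s -> 0 < q -> s + s <= q ->
  entourage q x y.
Proof.
intros Hx Hc Hq Hsq. destruct (chain_in x y s Hc) as [_ Hs].
(* The induction is on a bound [c] for the weight and covers all chains, end points and [q] at once;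
   removing an edge lowers the bound by [m]. *)
destruct (archimedean_ind (fun c => forall x y s q, x ∈ X -> chain m x y s -> s <= c ->
  0 < q -> s + s <= q -> entourage q x y) m) with (x := s) as (c & _ & H & Hsc); eauto.
- unfold chain, reach, entourage, near. definability.
- clear x y s q Hx Hc Hq Hsq Hs.
  intros x y s q Hx Hc Hs0 Hq _. destruct (chain_nonneg x y s Hc) as [_ H].
  rewrite (H Hs0). now apply entourage_refl.
- clear x y s q Hx Hc Hq Hsq Hs.
  intros c Hc IH x y s q Hx Hch Hsc Hq Hsq. destruct (chain_in x y s Hch) as [Hy Hs].
  destruct (chain_nonneg x y s Hch) as [Hs0 Hxy].
  destruct (le_or_lt s 0) as [Hle|Hpos]; auto with reals.
  { rewrite (Hxy Hle). now apply entourage_refl. }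
  destruct (half_pos_ex s Hpos) as (t & Ht & E).
  destruct (chain_split x y s t) as
    (x' & y' & a & w & b & Hy' & Ha & Hat & Hta & Hw & He & Hb & Es); eauto with reals.
  { rewrite <- E. apply lt_add_pos; eauto with reals. }
  destruct (chain_in x x' a Ha) as [Hx' HaR], (chain_in y' y b Hb) as [_ HbR].
  destruct (chain_nonneg x x' a Ha) as [Ha0 _], (chain_nonneg y' y b Hb) as [Hb0 _].
  assert (HwR : w ∈ R) by eauto with reals.
  assert (Hw0 : 0 <= w) by (apply (le_trans m); auto with reals).
  assert (Has : a + m <= s).
  { rewrite Es. apply (le_trans (a + w)); auto using le_add_nonneg with reals.
    apply add_le; auto using le_refl. }
  assert (Hbs : b + m <= s).
  { rewrite Es, (addC _ b) by auto with reals. apply add_le; [now apply le_refl|].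
    rewrite <- (add0 m), (addC a) by eauto with reals. now apply add_le. }
  assert (Hbt : b <= t).
  { apply (add_le_cancel b t t); eauto with reals. rewrite E, Es, (addC _ b) by auto with reals.
    apply add_le; auto using le_refl with reals. }
  assert (Hws : w <= s).
  { rewrite Es. apply (le_trans (a + w)); [|apply le_add_nonneg; auto with reals].
    rewrite addC by auto. now apply le_add_nonneg. }
  assert (Hm : forall u, u ∈ R -> u + m <= s -> u <= c).
  { intros u Hu Hus. apply (add_le_cancel u c m); eauto with reals. now apply (le_trans s). }
  (* All three pieces lie in [entourage s]: the outer ones since a + a and b + b are at most t + t =
     s, the middle edge since w is at most s. *)
  apply (entourage_comp s q x x' y' y); auto.
  + apply (IH x x' a s); auto. rewrite <- E. now apply add_le.
  + now apply (entourage_mono w).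
  + apply (IH y' y b s); auto. rewrite <- E. now apply add_le.
Qed.

End Chains.

Lemma chain_mono m m' x y s : m' <= m -> chain m x y s -> chain m' x y s.
Proof.
intro Hm. apply (chain_ind m x (fun y s => chain m' x y s)).
- apply definable_chain.
- intro Hx. now apply chain_refl.
- intros y0 s0 z w _ _ Hz _ _ H Hw He. apply (chain_edge m' x y0); auto.
  now apply (le_trans m).
Qed.

(** * The infimum of chain weights as a compatible metric *)

Definition chain_weight x y s : Prop := exists m, 0 < m /\ chain m x y s.

Lemma definable_chain_weight x y : definable1 (chain_weight x y).
Proof. unfold chain_weight, chain, reach, entourage, near. definability. Qed.

Lemma chain_weight_trans x y z s t :
  chain_weight x y s -> chain_weight y z t -> chain_weight x z (s + t).
Proof.
intros (m & Hm & H) (m' & Hm' & H').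
destruct (min_pos_ex m m' Hm Hm') as (m0 & Hm0 & Hle & Hle').
exists m0. split; [exact Hm0|].
apply (chain_trans m0 x y); [apply (chain_mono m)|apply (chain_mono m')]; auto.
Qed.

Lemma chain_weight_single x y w : x ∈ X -> y ∈ X -> 0 < w -> entourage w x y ->
  chain_weight x y w.
Proof.
intros Hx Hy Hw He. exists w. split; [exact Hw|].
apply chain_single; auto. apply le_refl. eauto with reals.
Qed.

(** The ambient [epsilon] names an infimum that is unique, and the value 0 outside [X] completes a
    definable operation. *)
Definition rho x y : M :=
  if excluded_middle_informative (x ∈ X /\ y ∈ X)
  then epsilon (inhabited_model) (is_inf (chain_weight x y)) else 0.

Lemma rho_is_inf x y : x ∈ X -> y ∈ X -> is_inf (chain_weight x y) (rho x y).
Proof.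
intros Hx Hy. unfold rho. destruct excluded_middle_informative as [_|]; [|tauto].
apply epsilon_spec, (inf_ex _ 0); auto with reals.
- apply definable_chain_weight.
(* An edge of weight 2 joins any two points, so the infimum is over a nonempty set. *)
- exists (1 + 1). split; [auto with reals|]. apply chain_weight_single; auto.
  + apply (lt_trans 1); auto using lt01. apply lt_add_pos; auto using lt01 with reals.
  + left. apply le_refl. auto with reals.
- intros s _ (m & Hm & H). now apply (chain_nonneg m Hm x y).
Qed.

Lemma definable_rho : definable_op rho.
Proof.
apply definable_ext with (fun e =>
  ((e 1%nat ∈ X /\ e 2%nat ∈ X) /\ is_inf (chain_weight (e 1%nat) (e 2%nat)) (e 0%nat)) \/
  (~ (e 1%nat ∈ X /\ e 2%nat ∈ X) /\ e 0%nat = 0)).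
- intro e. unfold rho. destruct excluded_middle_informative as [[H1 H2]|N]; [|tauto].
  pose proof (rho_is_inf (e 1%nat) (e 2%nat) H1 H2) as Hinf. unfold rho in Hinf.
  destruct excluded_middle_informative as [_|]; [|tauto]. split.
  + intros ->. auto.
  + intros [[_ H]|[N _]]; [|tauto]. exact (is_inf_unique _ _ _ H Hinf).
- unfold is_inf, chain_weight, chain, reach, entourage, near. definability.
Qed.

Lemma rho_in x y : x ∈ X -> y ∈ X -> rho x y ∈ R.
Proof. intros Hx Hy. exact (proj1 (rho_is_inf x y Hx Hy)). Qed.

Lemma rho_le x y s : x ∈ X -> y ∈ X -> chain_weight x y s -> rho x y <= s.
Proof.
intros Hx Hy H. destruct (rho_is_inf x y Hx Hy) as (_ & Hle & _).
apply Hle; [|exact H]. destruct H as (m & _ & H).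
now apply chain_in in H.
Qed.

Lemma rho_nonneg x y : x ∈ X -> y ∈ X -> 0 <= rho x y.
Proof.
intros Hx Hy. destruct (rho_is_inf x y Hx Hy) as (_ & _ & Hge).
apply Hge; [apply rzero_in|].
intros s _ (m & Hm & H). now apply (chain_nonneg m Hm x y).
Qed.

Lemma rho_sym_le x y : x ∈ X -> y ∈ X -> rho x y <= rho y x.
Proof.
intros Hx Hy. destruct (rho_is_inf y x Hy Hx) as (_ & _ & Hge).
apply Hge; [now apply rho_in|].
intros s _ (m & Hm & H). apply rho_le; auto. exists m. split; [exact Hm|].
now apply chain_sym.
Qed.

Lemma rho_triangle x y z : x ∈ X -> y ∈ X -> z ∈ X -> rho x y <= rho x z + rho z y.
Proof.
intros Hx Hy Hz. apply (is_inf_add (chain_weight x z) (chain_weight z y));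
  auto using rho_in, rho_is_inf.
intros s t _ _ Hs Ht. apply rho_le; auto. now apply (chain_weight_trans x z).
Qed.

(** The centre [x] itself witnesses that the two points are near, so a chain with one edge of weight
    e / 2 suffices. *)
Lemma rho_lt_of_d_lt e : 0 < e -> exists r, 0 < r /\
  forall x y, x ∈ X -> y ∈ X -> d x y < r -> rho x y < e.
Proof.
intro He. destruct (half_pos_ex e He) as (h & Hh & E).
destruct (entourage_of_near h Hh) as (r & Hr & H). exists r. split; [exact Hr|].
intros x y Hx Hy Hxy. apply (le_lt_trans h).
- apply rho_le; auto. apply chain_weight_single; auto. apply H.
  exists x. auto using d_refl_lt.
- rewrite <- E. apply lt_add_pos; eauto with reals.
Qed.

Lemma d_lt_of_rho_lt x e : x ∈ X -> 0 < e -> exists r, 0 < r /\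
  forall y, y ∈ X -> rho x y < r -> d x y < e.
Proof.
intros Hx He. destruct (near_in_ball x e Hx He) as (r0 & Hr0 & H).
(* A bound [q] of at most 1 excludes the clause of [entourage] that admits every pair. *)
destruct (min_pos_ex 1 r0 lt01 Hr0) as (q & Hq & Hq1 & Hqr).
destruct (half_pos_ex q Hq) as (h & Hh & E). exists h. split; [exact Hh|].
intros y Hy Hxy.
destruct (is_inf_lt _ _ _ (rho_is_inf x y Hx Hy) Hxy) as (s & _ & (m & Hm & Hc) & Hs).
apply H; auto. apply (near_mono q); auto. apply near_of_entourage; auto.
apply (chain_entourage m Hm x y s); auto. rewrite <- E. apply add_le; auto with reals.
Qed.

Lemma rho_metric : is_metric R X rho.
Proof.
split; [split; [|split; [|split]]|].
- apply set_function2_of_definable; [exact definable_rho|exact rho_in].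
- intros x y Hx Hy. apply (rho_nonneg x y Hx Hy).
- intros x y z Hx Hy Hz. rewrite <- add_eq by auto using rho_in.
  apply (rho_triangle x y z Hx Hy Hz).
- intros x y Hx Hy. split.
  + intro E. apply NNPP. intro N.
    (* With e = d(x, y), a vanishing [rho x y] would give d(x, y) < d(x, y). *)
    destruct (d_lt_of_rho_lt x (d x y) Hx (d_pos x y Hx Hy N)) as (r & Hr & H).
    destruct (H y Hy) as [_ F]; [now rewrite E|now apply F].
  + intros <-. apply le_antisym; [|now apply rho_nonneg].
    apply rho_le; auto. exists 1. split; [exact lt01|]. now apply chain_refl.
- intros x y Hx Hy. apply le_antisym; now apply rho_sym_le.
Qed.

Lemma eps_open_rho V : eps_open X d V <-> eps_open X rho V.
Proof.
split; intros [HV H]; (split; [exact HV|]); intros x HxV;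
  destruct (H x HxV) as (e & He & Hball).
- destruct (d_lt_of_rho_lt x e) as (r & Hr & Hlt); auto.
  exists r. split; [exact Hr|]. auto.
- destruct (rho_lt_of_d_lt e He) as (r & Hr & Hlt).
  exists r. split; [exact Hr|]. intros y Hy Hxy. auto.
Qed.

Lemma compatible_metric_ex :
  exists rho, is_metric R X rho /\ forall V, eps_open X d V <-> eps_open X rho V.
Proof. exists rho. split; [exact rho_metric|exact eps_open_rho]. Qed.

End Space.
End Reals.
End ZF.

Theorem corollary3p5 (M : set_structure) (zfM : is_model_of_ZF M)
    (R : real_field M) (X : M) (d : M -> M -> M)
    (d_qmetric : is_quasi_metric R X d)
    (X_compact : is_compact X (tau R X d))
    (X_hausdorff : is_hausdorff X (tau R X d))
    (Xconj_iso_dense : is_iso_dense X (tau R X (conjugate d))) :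
  is_metrizable R X (tau R X d).
Proof.
pose proof d_qmetric as (d_fun & d_nonneg & d_triangle & d_eq0).
(* With at most one point [d] is already symmetric; otherwise two separated points supply a nonempty
   open set. *)
destruct (classic (exists x y, x ∈ X /\ y ∈ X /\ x <> y)) as [(x0 & y0 & Hx0 & Hy0 & N)|N].
2: { exists d. split; [split; [exact d_qmetric|]|tauto].
  intros x y Hx Hy. destruct (classic (x = y)) as [->|Nxy]; [reflexivity|].
  destruct N. now exists x, y. }
assert (d_in : forall x y, x ∈ X -> y ∈ X -> d x y ∈ R) by apply d_fun.
(* The sequence 2^(-n) need not be constructed: a nonempty open set witnesses it. *)
assert (Hpow : has_neg_pow2 R).
{ destruct (X_hausdorff x0 y0 Hx0 Hy0 N) as (U & _ & [_ HU] & _ & Hx0U & _).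
  destruct (HU x0 Hx0U) as (w & n & r & Hw & Hn & Hr & _). now exists w, n, r. }
(* The construction of the metric takes a definable operation with values in [R] everywhere; [d'] is
   one and agrees with [d] on [X]. *)
set (d' := total_op X (rzero R) d).
assert (Ed : forall x y, x ∈ X -> y ∈ X -> d' x y = d x y)
  by (intros; now apply total_op_eq).
assert (d'_in : forall x y, d' x y ∈ R)
  by (intros; apply (total_op_in X R); [exact d_fun|apply rzero_in]).
assert (tau_d' : forall V, tau R X d V <-> eps_open R X d' V).
{ intro V. split.
  - intro H. apply (tau_eps_open zfM R X d V d_in) in H. destruct H as [HV H].
    split; [exact HV|]. intros x Hx. destruct (H x Hx) as (r & Hr & Hb).
    exists r. split; [exact Hr|]. intros y Hy. rewrite Ed by auto. auto.
  - intros [HV H]. apply (eps_open_tau zfM R X d V Hpow d_in). split; [exact HV|].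
    intros x Hx. destruct (H x Hx) as (r & Hr & Hb).
    exists r. split; [exact Hr|]. intros y Hy. rewrite <- Ed by auto. auto. }
destruct (compatible_metric_ex zfM R X d') as (rho & Hrho & H).
- now apply (definable_total_op zfM X R).
- exact d'_in.
- intros x y Hx Hy. rewrite Ed by auto. repeat split; auto using rzero_in.
- intros x y z Hx Hy Hz. rewrite !Ed, add_eq by auto. repeat split; auto.
  now apply (radd_set R); apply d_in.
- intros x y Hx Hy. rewrite Ed by auto. now apply d_eq0.
- intros U HU Hcov. apply X_compact; [|exact Hcov]. intros V HV. now apply tau_d', HU.
- intros x y Hx Hy Nxy. destruct (X_hausdorff x y Hx Hy Nxy) as (U & V & HU & HV & HUV).
  exists U, V. now rewrite <- !tau_d'.
- exists rho. split; [exact Hrho|]. intro V. rewrite tau_d', H.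
  assert (rho_in : forall x y, x ∈ X -> y ∈ X -> rho x y ∈ R) by apply Hrho.
  split; [now apply eps_open_tau|now apply tau_eps_open].
Qed.
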